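(* Let $\mathbb{K}$ be an algebraically closed field of characteristic zero, $X$ a smooth projective variety over $\mathbb{K}$ with $H^i(X,\mathcal{O}_X)=0$ for $i=1,2$, and $\mathcal{E}$ a locally free sheaf of $\mathcal{O}_X$-modules on $X$. The tangent space to the deformations of the pair $(\mathcal{E},H^0(X,\mathcal{E}))$ can be identified with $$t_{\mathrm{Def}_{(\mathcal{E},H^0(X,\mathcal{E}))}}=\{a\in H^1(X,\mathcal{E}nd(\mathcal{E}))\ \mid\ a\cup s=0\ \ \forall\,s\in H^0(X,\mathcal{E})\}.$$
   Context: $\mathcal{E}nd(\mathcal{E})$ is the sheaf of $\mathcal{O}_X$-linear endomorphisms of $\mathcal{E}$, and the cup product $H^1(X,\mathcal{E}nd(\mathcal{E}))\times H^0(X,\mathcal{E})\to H^1(X,\mathcal{E})$ is induced by evaluation. $\mathbf{Art}_{\mathbb{K}}$ is the category of local Artinian $\mathbb{K}$-algebras with residue field $\mathbb{K}$. For a deformation functor $F$, $t_F=F(\mathbb{K}[\epsilon])$, $\epsilon^2=0$. A deformation of $\mathcal{E}$ over $A\in\mathbf{Art}_{\mathbb{K}}$ is a locally free sheaf $\mathcal{E}_A$ of $\mathcal{O}_X\otimes A$-modules on $X\times\mathrm{Spec}\,A$ with a morphism $\pi_A:\mathcal{E}_A\to\mathcal{E}$ inducing $\mathcal{E}_A\otimes_A\mathbb{K}\cong\mathcal{E}$. For $U\subseteq H^0(X,\mathcal{E})$ a subspace, a deformation of $(\mathcal{E},U)$ over $A$ is $(\mathcal{E}_A,\pi_A,i_A)$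 with $(\mathcal{E}_A,\pi_A)$ a deformation of $\mathcal{E}$ and $i_A:U\otimes A\to H^0(X\times\mathrm{Spec}\,A,\mathcal{E}_A)$ a morphism (of $A$-modules) with $\pi_A\circ i_A=i\circ\pi$, where $\pi:U\otimes A\to U$ is the reduction and $i$ the inclusion. Two such are isomorphic if there are an isomorphism $\phi:\mathcal{E}_A\to\mathcal{E}'_A$ of $\mathcal{O}_X\otimes A$-modules with $\pi'_A\phi=\pi_A$ and an isomorphism $\psi:U\otimes A\to U\otimes A$ with $\phi\circ i_A=i'_A\circ\psi$. $\mathrm{Def}_{(\mathcal{E},U)}$ is the functor of isomorphism classes. The set of isomorphism classes of first order deformations of $\mathcal{E}$ is $H^1(X,\mathcal{E}nd(\mathcal{E}))$, and the identification is by forgetting $i_A$. *)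

(* Defs.v *)
(* Projective varieties are irreducible closed subsets of P^n over an
   algebraically closed field, with their Zariski topology and their sheaf of
   regular functions. The opens of the associated scheme and of its set of closed
   points correspond, so both have the same sheaves. *)
From HB Require Import structures.
From mathcomp Require Import all_boot all_order all_algebra.
From mathcomp Require Import boolp classical_sets functions cardinality.
From mathcomp Require Import topology_structure subtype_topology.
From mathcomp Require Import mpoly generic_quotient.

Set Implicit Arguments.
Unset Strict Implicit.
Unset Printing Implicit Defensive.

Import GRing.Theory.

Local Open Scope classical_set_scope.
Local Open Scope ring_scope.

Record opens (T : topologicalType) := Opens { oset :> set T; openP : open oset }.

Section Opens.
Context {T : topologicalType}.
Implicit Types U V W : opens T.

Definition oT : opens T := Opens openT.
Definition oI U V : opens T := Opens (openI (openP U) (openP V)).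

Lemma oIl U V : oI U V `<=` U. Proof. exact: subIsetl. Qed.
Lemma oIr U V : oI U V `<=` V. Proof. exact: subIsetr. Qed.

Lemma ocap_open n (U : 'I_n -> opens T) : open [set y | forall k, oset (U k) y].
Proof.
elim: n U => [|n IH] U.
  rewrite (_ : [set y | _] = setT); first exact: openT.
  by apply/seteqP; split => // y _ [].
rewrite (_ : [set y | _] = U ord0 `&` [set y | forall k, oset (U (lift ord0 k)) y]).
  by apply: openI; [exact: openP | exact: (IH (fun k => U (lift ord0 k)))].
apply/seteqP; split => [y h|y [h0 h] k]; first by split=> [|k] /=; exact: h.
by case: (unliftP ord0 k) => [j|] ->.
Qed.

Definition ocap n (U : 'I_n -> opens T) : opens T := Opens (ocap_open U).

End Opens.

Arguments oIl {T} U V [t] _.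
Arguments oIr {T} U V [t] _.

(* The sections over U are F U; a restriction map takes a proof of inclusion. *)
Definition is_sheaf (T : topologicalType) (F : opens T -> Type)
    (res : forall U V : opens T, V `<=` U -> F U -> F V) : Prop :=
  [/\ forall (U : opens T) (h : U `<=` U) (s : F U), res U U h s = s,
      forall (U V W : opens T) (h1 : V `<=` U) (h2 : W `<=` V) (h3 : W `<=` U) (s : F U),
        res V W h2 (res U V h1 s) = res U W h3 s
    & forall (I : Type) (U : opens T) (V : I -> opens T) (hV : forall i, V i `<=` U),
        U `<=` \bigcup_i V i ->
        forall s : (forall i, F (V i)),
        (forall i j, res _ _ (oIl (V i) (V j)) (s i)
                   = res _ _ (oIr (V i) (V j)) (s j)) ->
        exists! t : F U, forall i, res _ _ (hV i) t = s i].

Record ringSheaf (T : topologicalType) := RingSheaf {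
  rsec :> opens T -> comPzRingType;
  rres : forall U V : opens T, V `<=` U -> {rmorphism rsec U -> rsec V};
  rsheaf : is_sheaf (fun U V (h : V `<=` U) => rres h : rsec U -> rsec V) }.

Arguments rres {T r U V} h.

Record ringSheafHom (T : topologicalType) (R S : ringSheaf T) := RingSheafHom {
  rhom :> forall U : opens T, {rmorphism R U -> S U};
  rhom_res : forall (U V : opens T) (h : V `<=` U) (f : R U),
    rhom V (rres h f) = rres h (rhom U f) }.

Definition idRSH (T : topologicalType) (R : ringSheaf T) : ringSheafHom R R :=
  @RingSheafHom T R R (fun U => idfun) (fun _ _ _ _ => erefl).

Record modSheaf (T : topologicalType) (R : ringSheaf T) := ModSheaf {
  msec :> forall U : opens T, lmodType (R U);
  mres : forall U V : opens T, V `<=` U -> msec U -> msec V;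
  mresD : forall (U V : opens T) (h : V `<=` U), {morph mres h : s t / s + t};
  mresZ : forall (U V : opens T) (h : V `<=` U) (f : R U) (s : msec U),
    mres h (f *: s) = rres h f *: mres h s;
  msheaf : is_sheaf mres }.

Arguments mres {T R m U V} h.

(* Morphisms of sheaves of modules over a morphism rho of sheaves of rings; for
   rho the identity these are the linear ones. *)
Section Morphisms.
Context {T : topologicalType} {R S : ringSheaf T} (rho : ringSheafHom R S).
Variables (M : modSheaf R) (N : modSheaf S).

Record modSheafHom := ModSheafHom {
  mhom :> forall U : opens T, M U -> N U;
  mhomD : forall U : opens T, {morph mhom (U:=U) : s t / s + t};
  mhomZ : forall (U : opens T) (f : R U) (s : M U),
    mhom (f *: s) = rho U f *: mhom s;
  mhom_res : forall (U V : opens T) (h : V `<=` U) (s : M U),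
    mhom (mres h s) = mres h (mhom s) }.

(* The morphisms from M|_U to N|_U, as families indexed by the opens V of U. *)
Section Hom.
Variable U : opens T.

Definition is_hom (f : forall V : opens T, V `<=` U -> M V -> N V) : Prop :=
  [/\ forall (V : opens T) (h : V `<=` U), {morph f V h : s t / s + t},
      forall (V : opens T) (h : V `<=` U) (a : R V) (s : M V),
        f V h (a *: s) = rho V a *: f V h s
    & forall (V W : opens T) (hV : V `<=` U) (hW : W `<=` U) (h : W `<=` V) (s : M V),
        f W hW (mres h s) = mres h (f V hV s)].

Record hom_on := HomOn {
  homfun :> forall V : opens T, V `<=` U -> M V -> N V;
  homP : is_hom homfun }.

Lemma hom_onP (f g : hom_on) :
  (forall (V : opens T) (h : V `<=` U) s, f V h s = g V h s) -> f = g.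
Proof.
case: f g => [f fP] [g gP] /= e.
have {}e : f = g by do 3!apply: functional_extensionality_dep => ?; exact: e.
by subst g; congr HomOn; exact: Prop_irrelevance.
Qed.

HB.instance Definition _ := gen_eqMixin hom_on.
HB.instance Definition _ := gen_choiceMixin hom_on.

Lemma mres0 (V W : opens T) (h : W `<=` V) : mres h (0 : N V) = 0.
Proof. by apply: (addrI (mres h (0 : N V))); rewrite -mresD !addr0. Qed.

Lemma mresN (V W : opens T) (h : W `<=` V) (s : N V) : mres h (- s) = - mres h s.
Proof. by apply: (addrI (mres h s)); rewrite -mresD !subrr mres0. Qed.

Lemma zero_is_hom : is_hom (fun V _ _ => 0).
Proof.
split => [V _ s t|V _ a s|V W _ _ h s] /=; first by rewrite addr0.
  by rewrite scaler0.
by rewrite mres0.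
Qed.

Lemma opp_is_hom (f : hom_on) : is_hom (fun V h s => - f V h s).
Proof.
case: f => f [fD fZ fr]; split => [V h s t|V h a s|V W hV hW h s] /=.
- by rewrite fD opprD.
- by rewrite fZ scalerN.
- by rewrite (fr _ _ hV) mresN.
Qed.

Lemma add_is_hom (f g : hom_on) : is_hom (fun V h s => f V h s + g V h s).
Proof.
case: f g => f [fD fZ fr] [g [gD gZ gr]].
split => [V h s t|V h a s|V W hV hW h s] /=.
- by rewrite fD gD addrACA.
- by rewrite fZ gZ scalerDr.
- by rewrite (fr _ _ hV) (gr _ _ hV) mresD.
Qed.

Lemma scale_is_hom (a : S U) (f : hom_on) :
  is_hom (fun V h s => rres h a *: f V h s).
Proof.
case: f => f [fD fZ fr]; split => [V h s t|V h b s|V W hV hW h s] /=.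
- by rewrite fD scalerDr.
- by rewrite fZ !scalerA mulrC.
- by rewrite (fr _ _ hV) mresZ; have [_ -> _] := rsheaf S.
Qed.

Definition hom_zero := HomOn zero_is_hom.
Definition hom_opp f := HomOn (opp_is_hom f).
Definition hom_add f g := HomOn (add_is_hom f g).
Definition hom_scale a f := HomOn (scale_is_hom a f).

Fact hom_addA : associative hom_add.
Proof. by move=> f g k; apply: hom_onP => V h s /=; rewrite addrA. Qed.
Fact hom_addC : commutative hom_add.
Proof. by move=> f g; apply: hom_onP => V h s /=; rewrite addrC. Qed.
Fact hom_add0 : left_id hom_zero hom_add.
Proof. by move=> f; apply: hom_onP => V h s /=; rewrite add0r. Qed.
Fact hom_addN : left_inverse hom_zero hom_opp hom_add.
Proof. by move=> f; apply: hom_onP => V h s /=; rewrite addNr. Qed.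

HB.instance Definition _ :=
  GRing.isZmodule.Build hom_on hom_addA hom_addC hom_add0 hom_addN.

Fact hom_scaleA a b f : hom_scale a (hom_scale b f) = hom_scale (a * b) f.
Proof. by apply: hom_onP => V h s /=; rewrite rmorphM scalerA. Qed.
Fact hom_scale1 : left_id 1 hom_scale.
Proof. by move=> f; apply: hom_onP => V h s /=; rewrite rmorph1 scale1r. Qed.
Fact hom_scaleDr : right_distributive hom_scale +%R.
Proof. by move=> a f g; apply: hom_onP => V h s /=; rewrite scalerDr. Qed.
Fact hom_scaleDl f : {morph hom_scale^~ f : a b / a + b}.
Proof. by move=> a b; apply: hom_onP => V h s /=; rewrite rmorphD scalerDl. Qed.

HB.instance Definition _ := GRing.Zmodule_isLmodule.Build (S U) hom_on
  hom_scaleA hom_scale1 hom_scaleDr hom_scaleDl.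

End Hom.

Lemma hom_res_subproof (U V : opens T) (h : V `<=` U) (f : hom_on U) :
  is_hom (fun (W : opens T) (k : W `<=` V) => f W (subset_trans k h)).
Proof.
case: f => f [fD fZ fr]; split => [W k s t|W k b s|W W' hV hW k s] /=.
- exact: fD.
- exact: fZ.
- exact: fr.
Qed.

Definition hom_res (U V : opens T) (h : V `<=` U) (f : hom_on U) : hom_on V :=
  HomOn (hom_res_subproof h f).

Lemma hom_resD (U V : opens T) (h : V `<=` U) :
  {morph hom_res h : f g / f + g}.
Proof. by move=> f g; apply: hom_onP. Qed.

Lemma hom_resZ (U V : opens T) (h : V `<=` U) (a : S U) (f : hom_on U) :
  hom_res h (a *: f) = rres h a *: hom_res h f.
Proof.
apply: hom_onP => W k s /=; have [_ rc _] := rsheaf S.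
by congr (_ *: _); rewrite -(rc _ _ _ h k).
Qed.

Lemma oI_sub (U V W : opens T) : V `<=` U -> oI V W `<=` U.
Proof. by move=> h x [/h]. Qed.

Lemma hom_sheaf : is_sheaf hom_res.
Proof.
have [Nid Ncomp Nglue] := msheaf N.
have [Mid Mcomp _] := msheaf M.
have homirr (U : opens T) (f : hom_on U) (V : opens T) (h k : V `<=` U) s :
  f V h s = f V k s by congr (f V _ s); exact: Prop_irrelevance.
split=> [U h f|U V W h1 h2 h3 f|I U V hV cov f fcompat].
- by apply: hom_onP => V k s /=; exact: homirr.
- by apply: hom_onP => W' k s /=; exact: homirr.
have fE i j (W : opens T) (hi : W `<=` V i) (hj : W `<=` V j) s :
    f i W hi s = f j W hj s.
  have hW : W `<=` oI (V i) (V j) by move=> x Wx; split; [exact: hi|exact: hj].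
  have := congr1 (fun g : hom_on (oI (V i) (V j)) => g W hW s) (fcompat i j).
  by rewrite /= (homirr _ _ _ _ hi) => ->; exact: homirr.
have fres i := let: And3 _ _ r := homP (f i) in r.
have glueW (W : opens T) (hW : W `<=` U) (s : M W) : exists! t : N W,
    forall i, mres (oIl W (V i)) t
      = f i (oI W (V i)) (oIr W (V i))
          (mres (oIl W (V i)) s).
  apply: Nglue.
    by move=> x Wx; have [i _ Vx] := cov x (hW x Wx); exists i.
  move=> i j.
  set Wi := oI W (V i); set Wj := oI W (V j).
  have ki : oI Wi Wj `<=` V i by move=> x [[]].
  have kj : oI Wi Wj `<=` V j by move=> x [_ []].
  rewrite -(fres i _ _ _ ki) -(fres j _ _ _ kj).
  have kW : oI Wi Wj `<=` W by move=> x [[]].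
  by rewrite !(Mcomp _ _ _ _ _ kW); exact: fE.
pose g W hW s := projT1 (cid (glueW W hW s)).
have gP W hW s i : mres (oIl W (V i)) (g W hW s)
      = f i (oI W (V i)) (oIr W (V i))
          (mres (oIl W (V i)) s).
  by rewrite /g; case: cid => t [/= tP _]; exact: tP.
have gU W hW s t : (forall i, mres (oIl W (V i)) t
      = f i (oI W (V i)) (oIr W (V i))
          (mres (oIl W (V i)) s)) -> g W hW s = t.
  by move=> tP; rewrite /g; case: cid => t' [/= _]; apply.
have gV i (W : opens T) (hW : W `<=` U) (hi : W `<=` V i) s : g W hW s = f i W hi s.
  apply: gU => j.
  have ki : oI W (V j) `<=` V i by move=> x [/hi].
  by rewrite -(fres i _ _ _ ki); exact: fE.
have g_hom : is_hom g.
  split=> [W hW s t|W hW a s|W W' hW hW' h s].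
  - apply: gU => i; rewrite !mresD !gP.
    by have [fD _ _] := homP (f i); rewrite fD.
  - apply: gU => i; rewrite !mresZ !gP.
    by have [_ fZ _] := homP (f i); rewrite fZ rhom_res.
  - apply: gU => i.
    have k : oI W' (V i) `<=` oI W (V i) by move=> x [/h].
    have k' : oI W' (V i) `<=` W by move=> x [/h].
    rewrite (Ncomp _ _ _ _ _ k') -(Ncomp _ _ _ (oIl W (V i)) k) gP.
    by rewrite -(fres i _ _ _ (oIr W' (V i))) !(Mcomp _ _ _ _ _ k').
exists (HomOn g_hom); split=> [i|f' f'P].
  by apply: hom_onP => W k s /=; exact: gV.
apply: hom_onP => W hW s /=; apply: gU => i.
have [_ _ fr'] := homP f'.
rewrite -(fr' _ _ _ (oI_sub hW)) -f'P /=.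
exact: homirr.
Qed.

Definition homSheaf : modSheaf S := ModSheaf hom_resD hom_resZ hom_sheaf.

End Morphisms.

Section Cech.
Context {T : topologicalType} {R : ringSheaf T}.

Local Open Scope quotient_scope.

(* Cech cohomology is the colimit over open covers. As in Godement, covers are
   indexed by the points of the space: they are cofinal among all covers, and a
   finer cover has a canonical refinement map. *)
Record pcover := Cover {
  cov :> T -> opens T;
  covP : forall x, oset (cov x) x }.

Definition finer (V U : pcover) : Prop := forall x, V x `<=` U x.

Lemma finer_refl U : finer U U. Proof. by move=> x y. Qed.

Lemma meet_coverP (U V : pcover) x : oset (oI (U x) (V x)) x.
Proof. by split; exact: covP. Qed.
Definition meet_cover U V := Cover (meet_coverP U V).

Lemma meet_finerl U V : finer (meet_cover U V) U. Proof. by move=> x; exact: oIl. Qed.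
Lemma meet_finerr U V : finer (meet_cover U V) V. Proof. by move=> x; exact: oIr. Qed.
Lemma finer_trans V U W : finer V U -> finer W V -> finer W U.
Proof. by move=> h k x; exact: subset_trans (k x) (h x). Qed.

Definition ccap (U : pcover) p (x : 'I_p -> T) : opens T := ocap (fun k => U (x k)).

Lemma ccap_face (U : pcover) p (x : 'I_p.+1 -> T) (k : 'I_p.+1) :
  ccap U x `<=` ccap U (fun j => x (lift k j)).
Proof. by move=> y h j; exact: h. Qed.

Lemma ccap_finer (U V : pcover) (h : finer V U) p (x : 'I_p -> T) :
  ccap V x `<=` ccap U x.
Proof. by move=> y hy j; exact: h. Qed.

Arguments ccap_face U [p] x k [t] _.
Arguments ccap_finer [U V] h [p] x [t] _.

Section Complex.
Variable M : modSheaf R.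

(* Non-alternating cochains. *)
Definition cochain (U : pcover) (p : nat) : Type := forall x : 'I_p.+1 -> T, M (ccap U x).

Section CochainModule.
Variables (U : pcover) (p : nat).
Implicit Types a b c : cochain U p.

HB.instance Definition _ := gen_eqMixin (cochain U p).
HB.instance Definition _ := gen_choiceMixin (cochain U p).

Lemma cochainP a b : (forall x, a x = b x) -> a = b.
Proof. exact: functional_extensionality_dep. Qed.

Definition cochain_zero : cochain U p := fun x => 0.
Definition cochain_opp a : cochain U p := fun x => - a x.
Definition cochain_add a b : cochain U p := fun x => a x + b x.
Definition cochain_scale (f : R oT) a : cochain U p :=
  fun x => rres (@subsetT _ (ccap U x) : ccap U x `<=` oT) f *: a x.

Fact cochain_addA : associative cochain_add.
Proof. by move=> a b c; apply: cochainP => x; exact: addrA. Qed.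
Fact cochain_addC : commutative cochain_add.
Proof. by move=> a b; apply: cochainP => x; exact: addrC. Qed.
Fact cochain_add0 : left_id cochain_zero cochain_add.
Proof. by move=> a; apply: cochainP => x; exact: add0r. Qed.
Fact cochain_addN : left_inverse cochain_zero cochain_opp cochain_add.
Proof. by move=> a; apply: cochainP => x; exact: addNr. Qed.

HB.instance Definition _ := GRing.isZmodule.Build (cochain U p)
  cochain_addA cochain_addC cochain_add0 cochain_addN.

Fact cochain_scaleA f g a :
  cochain_scale f (cochain_scale g a) = cochain_scale (f * g) a.
Proof. by apply: cochainP => x; rewrite /cochain_scale scalerA rmorphM. Qed.
Fact cochain_scale1 : left_id 1 cochain_scale.
Proof. by move=> a; apply: cochainP => x; rewrite /cochain_scale rmorph1 scale1r. Qed.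
Fact cochain_scaleDr : right_distributive cochain_scale +%R.
Proof. by move=> f a b; apply: cochainP => x; exact: scalerDr. Qed.
Fact cochain_scaleDl a : {morph cochain_scale^~ a : f g / f + g}.
Proof. by move=> f g; apply: cochainP => x; rewrite /cochain_scale rmorphD scalerDl. Qed.

HB.instance Definition _ := GRing.Zmodule_isLmodule.Build (R oT) (cochain U p)
  cochain_scaleA cochain_scale1 cochain_scaleDr cochain_scaleDl.

Lemma cochainDE a b x : (a + b) x = a x + b x. Proof. by []. Qed.
Lemma cochainZE f a x :
  (f *: a) x = rres (@subsetT _ (ccap U x) : ccap U x `<=` oT) f *: a x.
Proof. by []. Qed.

Definition delta (a : cochain U p) : cochain U p.+1 := fun x =>
  \sum_(k < p.+2) (-1) ^+ k *: mres (ccap_face U x k) (a (fun j => x (lift k j))).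

End CochainModule.

Definition cres (U V : pcover) (h : finer V U) p (a : cochain U p) : cochain V p :=
  fun x => mres (ccap_finer h x) (a x).

Fact delta_linear U p : linear (@delta U p).
Proof.
move=> f a b; apply: cochainP => x.
rewrite cochainDE cochainZE /delta scaler_sumr -big_split /=; apply: eq_bigr => k _.
rewrite cochainDE cochainZE mresD mresZ scalerDr !scalerA [in RHS]mulrC.
by have [_ rc _] := rsheaf R; congr (_ * _ *: _ + _); exact: rc.
Qed.
HB.instance Definition _ U p := GRing.isLinear.Build _ _ _ _ (@delta U p) (@delta_linear U p).

Fact cres_linear U V (h : finer V U) p : linear (@cres U V h p).
Proof.
move=> f a b; apply: cochainP => x.
rewrite cochainDE cochainZE /cres cochainDE cochainZE mresD mresZ.
by have [_ rc _] := rsheaf R; congr (_ *: _ + _); exact: rc.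
Qed.
HB.instance Definition _ U V h p :=
  GRing.isLinear.Build _ _ _ _ (@cres U V h p) (@cres_linear U V h p).

Lemma cres_delta U V (h : finer V U) p (a : cochain U p) :
  delta (cres h a) = cres h (delta a).
Proof.
apply: cochainP => x; rewrite /cres /delta.
rewrite (big_morph _ (mresD (ccap_finer h x)) (mres0 _ _)).
apply: eq_bigr => k _; rewrite mresZ rmorphXn rmorphN1; congr (_ *: _).
have [_ mc _] := msheaf M.
have k0 : ccap V x `<=` ccap U (fun j => x (lift k j)).
  by move=> y hy j; exact: h.
by rewrite !(mc _ _ _ _ _ k0).
Qed.

Lemma cres_comp U V W (h : finer V U) (k : finer W V) p (a : cochain U p) :
  cres k (cres h a) = cres (finer_trans h k) a.
Proof. by apply: cochainP => x; have [_ mc _] := msheaf M; exact: mc. Qed.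

Lemma cres_irr U V (h k : finer V U) p (a : cochain U p) : cres h a = cres k a.
Proof. by congr (cres _ a); exact: Prop_irrelevance. Qed.

Definition coboundary (U : pcover) p : cochain U p -> Prop :=
  match p with
  | 0 => fun a => a = 0
  | q.+1 => fun a => exists b : cochain U q, a = delta b
  end.

Lemma coboundary0 U p : @coboundary U p 0.
Proof. by case: p => //= p; exists 0; rewrite linear0. Qed.
Lemma coboundaryB U p (a b : cochain U p) :
  coboundary a -> coboundary b -> coboundary (a - b).
Proof.
case: p a b => [|p] a b /=; first by move=> -> ->; rewrite subr0.
by move=> [c ->] [d ->]; exists (c - d); rewrite linearB.
Qed.
Lemma coboundaryN U p (a : cochain U p) : coboundary a -> coboundary (- a).
Proof. by rewrite -sub0r; apply: coboundaryB; exact: coboundary0. Qed.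
Lemma coboundaryD U p (a b : cochain U p) :
  coboundary a -> coboundary b -> coboundary (a + b).
Proof. by move=> ca cb; rewrite -[b]opprK; apply/coboundaryB/coboundaryN. Qed.
Lemma coboundaryZ U p f (a : cochain U p) : coboundary a -> coboundary (f *: a).
Proof.
case: p a => [|p] a /=; first by move=> ->; rewrite scaler0.
by move=> [c ->]; exists (f *: c); rewrite linearZ.
Qed.
Lemma coboundary_res U V (h : finer V U) p (a : cochain U p) :
  coboundary a -> coboundary (cres h a).
Proof.
case: p a => [|p] a /=; first by move=> ->; rewrite linear0.
by move=> [c ->]; exists (cres h c); rewrite cres_delta.
Qed.

Record cocycle (p : nat) := Cocycle {
  coc_cover : pcover;
  coc : cochain coc_cover p;
  cocP : delta coc = 0 }.

(* Equality of classes in the colimit: the difference is a coboundary on a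
   common refinement. *)
Definition cohomologous p (a b : cocycle p) : Prop :=
  exists W (ha : finer W (coc_cover a)) (hb : finer W (coc_cover b)),
    coboundary (cres ha (coc a) - cres hb (coc b)).

HB.instance Definition _ p := gen_eqMixin (cocycle p).
HB.instance Definition _ p := gen_choiceMixin (cocycle p).

Lemma cohomologous_refl p (a : cocycle p) : cohomologous a a.
Proof. by exists (coc_cover a), (@finer_refl _), (@finer_refl _); rewrite subrr; exact: coboundary0. Qed.
Lemma cohomologous_sym p (a b : cocycle p) : cohomologous a b -> cohomologous b a.
Proof.
by move=> [W [ha [hb c]]]; exists W, hb, ha; rewrite -opprB; exact: coboundaryN.
Qed.
Lemma cohomologous_trans p (b a c : cocycle p) :
  cohomologous a b -> cohomologous b c -> cohomologous a c.
Proof.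
move=> [W1 [ha [hb cab]]] [W2 [hb' [hc cbc]]].
pose h1 := @meet_finerl W1 W2; pose h2 := @meet_finerr W1 W2.
exists (meet_cover W1 W2), (finer_trans ha h1), (finer_trans hc h2).
have := coboundaryD (coboundary_res h1 cab) (coboundary_res h2 cbc).
rewrite !linearB /= !cres_comp (cres_irr (finer_trans hb h1) (finer_trans hb' h2)).
by rewrite addrA subrK.
Qed.

Definition cohom_rel p (a b : cocycle p) : bool := `[< cohomologous a b >].
Fact cohom_rel_equiv p : equiv_class_of (@cohom_rel p).
Proof.
split=> [a|a b|b a c]; first exact/asboolP/cohomologous_refl.
  by apply/asboolP/asboolP; exact: cohomologous_sym.
by move=> /asboolP ab /asboolP bc; apply/asboolP; exact: cohomologous_trans ab bc.
Qed.
Canonical cohom_equiv p := EquivRelPack (cohom_rel_equiv p).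

Definition cechH (p : nat) : Type := {eq_quot (@cohom_rel p)}.
HB.instance Definition _ p := Choice.on (cechH p).
HB.instance Definition _ p := EqQuotient.on (cechH p).

Definition cls p (a : cocycle p) : cechH p := \pi_(cechH p) a.

Lemma clsE p (a b : cocycle p) : cls a = cls b <-> cohomologous a b.
Proof. by split=> [/eqmodP/asboolP|h]; last exact/eqmodP/asboolP. Qed.

Section CohomologyModule.
Variable p : nat.
Implicit Types a b : cocycle p.

Lemma cocP_res a V (h : finer V (coc_cover a)) : delta (cres h (coc a)) = 0.
Proof. by rewrite cres_delta cocP linear0. Qed.

Definition cover_T : pcover := @Cover (fun=> oT) (fun=> I).

Definition coc_zero : cocycle p := @Cocycle p cover_T 0 (linear0 _).
Lemma coc_opp_subproof a : delta (- coc a) = 0.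
Proof. by rewrite linearN /= cocP oppr0. Qed.
Definition coc_opp a : cocycle p := Cocycle (coc_opp_subproof a).

Lemma coc_scale_subproof f a : delta (f *: coc a) = 0.
Proof. by rewrite linearZ /= cocP scaler0. Qed.
Definition coc_scale f a : cocycle p := Cocycle (coc_scale_subproof f a).

Lemma coc_add_subproof a b :
  delta (cres (@meet_finerl (coc_cover a) (coc_cover b)) (coc a)
       + cres (@meet_finerr (coc_cover a) (coc_cover b)) (coc b)) = 0.
Proof. by rewrite linearD /= !cocP_res addr0. Qed.
Definition coc_add a b : cocycle p := Cocycle (coc_add_subproof a b).

Definition cechH_zero : cechH p := cls coc_zero.
Definition cechH_opp (x : cechH p) : cechH p := cls (coc_opp (repr x)).
Definition cechH_add (x y : cechH p) : cechH p := cls (coc_add (repr x) (repr y)).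
Definition cechH_scale f (x : cechH p) : cechH p := cls (coc_scale f (repr x)).

Lemma cls_repr (x : cechH p) : cls (repr x) = x. Proof. exact: reprK. Qed.

Lemma cohom_repr a : cohomologous (repr (cls a)) a.
Proof. by apply/clsE; rewrite cls_repr. Qed.

Lemma coboundary_eq U (a b : cochain U p) : a = b -> coboundary (a - b).
Proof. by move=> ->; rewrite subrr; exact: coboundary0. Qed.

Lemma coc_add_cohom a a' b b' :
  cohomologous a a' -> cohomologous b b' -> cohomologous (coc_add a b) (coc_add a' b').
Proof.
move=> [W1 [h1 [h1' c1]]] [W2 [h2 [h2' c2]]].
pose k1 := @meet_finerl W1 W2; pose k2 := @meet_finerr W1 W2.
have g x y (hx : finer W1 x) (hy : finer W2 y) :
    finer (meet_cover W1 W2) (meet_cover x y).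
  by move=> z t [/hx ? /hy].
exists (meet_cover W1 W2), (g _ _ h1 h2), (g _ _ h1' h2').
have := coboundaryD (coboundary_res k1 c1) (coboundary_res k2 c2).
rewrite !linearB !linearD /= !cres_comp.
rewrite addrACA => c; apply: (eq_ind _ (@coboundary _ _) c).
by congr (_ + _ + (- _ - _)); exact: cres_irr.
Qed.

Lemma clsD a b : cechH_add (cls a) (cls b) = cls (coc_add a b).
Proof. by apply/clsE/coc_add_cohom; exact: cohom_repr. Qed.

Lemma clsN a : cechH_opp (cls a) = cls (coc_opp a).
Proof.
apply/clsE; have [W [h [h' c]]] := cohom_repr a.
by exists W, h, h'; rewrite !linearN /= -opprD; exact: coboundaryN.
Qed.

Lemma clsZ f a : cechH_scale f (cls a) = cls (coc_scale f a).
Proof.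
apply/clsE; have [W [h [h' c]]] := cohom_repr a.
exists W, h, h'; rewrite /= !linearZZ. rewrite -scalerDr; exact: coboundaryZ.
Qed.

Lemma clsP (x : cechH p) : exists a, x = cls a.
Proof. by exists (repr x); rewrite cls_repr. Qed.

Fact cechH_addA : associative cechH_add.
Proof.
move=> x y z; have [a ->] := clsP x; have [b ->] := clsP y; have [c ->] := clsP z.
rewrite !clsD; apply/clsE.
pose A := coc_cover a; pose B := coc_cover b; pose C := coc_cover c.
have h1 : finer (meet_cover A (meet_cover B C)) (meet_cover (meet_cover A B) C).
  by move=> t s [? []].
exists (meet_cover A (meet_cover B C)), (@finer_refl _), h1; apply: coboundary_eq.
rewrite /= !linearD /= !cres_comp addrA.
by congr (_ + _ + _); exact: cres_irr.
Qed.
Fact cechH_addC : commutative cechH_add.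
Proof.
move=> x y; have [a ->] := clsP x; have [b ->] := clsP y.
rewrite !clsD; apply/clsE.
pose A := coc_cover a; pose B := coc_cover b.
have h1 : finer (meet_cover A B) (meet_cover B A) by move=> t s [].
exists (meet_cover A B), (@finer_refl _), h1; apply: coboundary_eq.
rewrite /= !linearD /= !cres_comp addrC.
by congr (_ + _); exact: cres_irr.
Qed.
Fact cechH_add0 : left_id cechH_zero cechH_add.
Proof.
move=> x; have [a ->] := clsP x; rewrite /cechH_zero clsD; apply/clsE.
have h1 : finer (coc_cover a) (meet_cover cover_T (coc_cover a)) by [].
exists (coc_cover a), h1, (@finer_refl _); apply: coboundary_eq.
rewrite /= linearD /= !linear0 add0r cres_comp; exact: cres_irr.
Qed.
Fact cechH_addN : left_inverse cechH_zero cechH_opp cechH_add.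
Proof.
move=> x; have [a ->] := clsP x; rewrite /cechH_zero clsN clsD; apply/clsE.
have h1 : finer (coc_cover a) (meet_cover (coc_cover a) (coc_cover a)) by [].
exists (coc_cover a), h1, (fun _ _ _ => I); apply: coboundary_eq.
rewrite /= linearD /= !linear0 !linearN /= !cres_comp.
by rewrite (cres_irr (finer_trans (@meet_finerl _ _) _) (finer_trans (@meet_finerr _ _) h1)) addNr.
Qed.

HB.instance Definition _ := GRing.isZmodule.Build (cechH p)
  cechH_addA cechH_addC cechH_add0 cechH_addN.

Fact cechH_scaleA f g x : cechH_scale f (cechH_scale g x) = cechH_scale (f * g) x.
Proof.
have [a ->] := clsP x; rewrite !clsZ; apply/clsE.
by exists (coc_cover a), (@finer_refl _), (@finer_refl _); apply: coboundary_eq; rewrite /= scalerA.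
Qed.
Fact cechH_scale1 : left_id 1 cechH_scale.
Proof.
move=> x; have [a ->] := clsP x; rewrite !clsZ; apply/clsE.
by exists (coc_cover a), (@finer_refl _), (@finer_refl _); apply: coboundary_eq; rewrite /= scale1r.
Qed.
Fact cechH_scaleDr : right_distributive cechH_scale +%R.
Proof.
move=> f x y; have [a ->] := clsP x; have [b ->] := clsP y.
rewrite [cls a + _]clsD !clsZ [RHS]clsD; apply/clsE.
exists (meet_cover (coc_cover a) (coc_cover b)), (@finer_refl _), (@finer_refl _); apply: coboundary_eq.
by rewrite /= scalerDr !linearZZ.
Qed.
Fact cechH_scaleDl x : {morph cechH_scale^~ x : f g / f + g}.
Proof.
move=> f g; have [a ->] := clsP x.
rewrite !clsZ [RHS]clsD; apply/clsE.
have h1 : finer (coc_cover a) (meet_cover (coc_cover a) (coc_cover a)) by [].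
exists (coc_cover a), (@finer_refl _), h1; apply: coboundary_eq.
rewrite /= scalerDl !linearD /= !cres_comp.
by congr (_ + _); exact: cres_irr.
Qed.

HB.instance Definition _ := GRing.Zmodule_isLmodule.Build (R oT) (cechH p)
  cechH_scaleA cechH_scale1 cechH_scaleDr cechH_scaleDl.

End CohomologyModule.
End Complex.

Section Functoriality.
Variables (M N : modSheaf R) (phi : modSheafHom (idRSH R) M N).

Definition cochain_map U p (a : cochain M U p) : cochain N U p :=
  fun x => phi _ (a x).

Lemma mhom0 U : phi U 0 = 0.
Proof. by apply: (addrI (phi U 0)); rewrite -mhomD !addr0. Qed.

Lemma delta_map U p (a : cochain M U p) :
  delta (cochain_map a) = cochain_map (delta a).
Proof.
apply: cochainP => x; rewrite /cochain_map /delta.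
rewrite (big_morph _ (@mhomD _ _ _ _ _ _ phi _) (mhom0 _)).
by apply: eq_bigr => k _; rewrite mhomZ mhom_res.
Qed.

Lemma coc_map_subproof p (a : cocycle M p) : delta (cochain_map (coc a)) = 0.
Proof.
by rewrite delta_map cocP; apply: cochainP => x; exact: mhom0.
Qed.
Definition coc_map p (a : cocycle M p) : cocycle N p :=
  Cocycle (coc_map_subproof a).

Definition cechH_map p (x : cechH M p) : cechH N p := cls (coc_map (repr x)).

Lemma cechH_mapE p (a : cocycle M p) : cechH_map (cls a) = cls (coc_map a).
Proof.
apply/clsE; have [W [h [h' c]]] := cohom_repr a; exists W, h, h'.
have -> : cres h (coc (coc_map (repr (cls a)))) - cres h' (coc (coc_map a))
    = cochain_map (cres h (coc (repr (cls a))) - cres h' (coc a)).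
  apply: cochainP => x; rewrite /cochain_map /=.
  apply: (addIr (phi _ (cres h' (coc a) x))); rewrite -mhomD.
  rewrite [in RHS]cochainDE [in LHS]cochainDE -addrA.
  rewrite [X in _ + X](_ : _ = 0); last by rewrite [in X in _ + X]/cres mhom_res; exact: addNr.
  rewrite -addrA [X in phi _ (_ + X)](_ : _ = 0); last exact: addNr.
  by rewrite !addr0 /cres mhom_res.
case: p a h h' c => [|p] a h h' /=.
  by move=> ->; apply: cochainP => x; exact: mhom0.
by move=> [b ->]; exists (cochain_map b); rewrite delta_map.
Qed.
End Functoriality.
End Cech.

(* The points of P^n are the lines of K^(n+1). *)
Definition projSpace (K : fieldType) (n : nat) : Type :=
  {L : {vspace 'rV[K]_n.+1} | \dim L == 1}.

Section ProjectiveSpace.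
Context {K : fieldType} {n : nat}.
Implicit Types (f g : {mpoly K[n.+1]}) (L : projSpace K n).

HB.instance Definition _ := Choice.on (projSpace K n).

(* Homogeneous coordinates: vpick chooses a nonzero vector of the line. Zeros of
   homogeneous polynomials, and ratios of those of equal degree, do not depend
   on the choice. *)
Definition homcoord L : 'I_n.+1 -> K := fun i => vpick (val L) 0 i.

Definition homogeneous f : Prop := exists d : nat, f \is d.-homog.

Definition zeros (S : set {mpoly K[n.+1]}) : set (projSpace K n) :=
  [set L | forall f, S f -> f.@[homcoord L] = 0].

Definition algebraic (Z : set (projSpace K n)) : Prop :=
  exists2 S : set {mpoly K[n.+1]}, S `<=` homogeneous & Z = zeros S.

(* The Zariski topology. *)
Let zopen (U : set (projSpace K n)) : Prop := algebraic (~` U).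

Fact zopenT : zopen setT.
Proof.
exists [set 1] => [f -> /=|]; first by exists 0%N; exact: dhomog1.
apply/seteqP; split => L /=; first by case.
by move=> /(_ 1 erefl) /eqP; rewrite meval1 oner_eq0.
Qed.

Fact zopenI : setI_closed zopen.
Proof.
move=> U V [S hS eS] [S' hS' eS'].
exists [set h | exists f g, [/\ S f, S' g & h = f * g]].
  move=> h [f [g [Sf S'g ->]]].
  have [d fd] := hS _ Sf; have [e ge] := hS' _ S'g.
  by exists (d + e)%N; exact: dhomogM.
rewrite setCI eS eS'; apply/seteqP; split=> L /=.
  by case=> hL _ [f [g [Sf S'g ->]]]; rewrite mevalM;
      [rewrite (hL _ Sf) mul0r | rewrite (hL _ S'g) mulr0].
move=> hL; apply: contrapT => /not_orP[/existsNP[f /not_implyP[Sf nf]]].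
move=> /existsNP[g /not_implyP[Sg /eqP ng]].
have /eqP := hL (f * g) (ex_intro _ f (ex_intro _ g (And3 Sf Sg erefl))).
by rewrite mevalM mulf_eq0 (negbTE ng) orbF => /eqP.
Qed.

Fact zopen_bigU (I : Type) (F : I -> set (projSpace K n)) :
  (forall i, zopen (F i)) -> zopen (\bigcup_i F i).
Proof.
move=> hF.
exists [set f | exists i (S : set {mpoly K[n.+1]}),
    [/\ S `<=` homogeneous, ~` F i = zeros S & S f]].
  by move=> f [i [S [hS _ Sf]]]; exact: hS.
rewrite setC_bigcup; apply/seteqP; split=> L /=.
  by move=> hL f [i [S [_ e Sf]]]; have := hL i Logic.I; rewrite e; exact.
move=> hL i _; have [S hS e] := hF i; rewrite e => f Sf.
by apply: hL; exists i, S.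
Qed.

HB.instance Definition _ :=
  isOpenTopological.Build (projSpace K n) zopenT zopenI zopen_bigU.

End ProjectiveSpace.

Definition irreducible (T : topologicalType) (Z : set T) : Prop :=
  Z !=set0 /\ forall A B : set T, closed A -> closed B ->
    Z `<=` A `|` B -> Z `<=` A \/ Z `<=` B.

Definition irr_chain (T : topologicalType) (X : set T) (d : nat) : Prop :=
  exists Z : 'I_d.+1 -> set T,
    (forall i, [/\ closed (Z i), irreducible (Z i) & Z i `<=` X]) /\
    (forall i j : 'I_d.+1, (i < j)%N -> Z i `<` Z j).

Definition krull_dim (T : topologicalType) (X : set T) (d : nat) : Prop :=
  irr_chain X d /\ forall e : nat, irr_chain X e -> (e <= d)%N.

(* W is the tangent space at x of the affine cone over X (at the vector
   homcoord x): the common kernel of the differentials of the homogeneous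
   polynomials vanishing on X. Its dimension is one more than that of the
   tangent space of X at x. *)
Definition is_tangent_space (K : fieldType) (n : nat) (X : set (projSpace K n)) (x : projSpace K n)
    (W : {vspace 'rV[K]_n.+1}) : Prop :=
  forall w : 'rV[K]_n.+1, w \in W <->
    forall f : {mpoly K[n.+1]}, homogeneous f ->
      (forall y, X y -> f.@[homcoord y] = 0) ->
      \sum_i (mderiv i f).@[homcoord x] * w 0 i = 0.

(* The Jacobian criterion. *)
Definition smooth (K : fieldType) (n : nat) (X : set (projSpace K n)) : Prop :=
  exists2 d : nat, krull_dim X d &
    forall x, X x -> exists2 W, is_tangent_space X x W & \dim W = d.+1.

Section StructureSheaf.
Context {K : fieldType} {n : nat} (X : set (projSpace K n)).

Definition ratio (q : {mpoly K[n.+1]} * {mpoly K[n.+1]}) (x : X) : K :=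
  q.1.@[homcoord (val x)] / q.2.@[homcoord (val x)].

Definition is_ratio (W : opens X) (q : {mpoly K[n.+1]} * {mpoly K[n.+1]}) : Prop :=
  (exists d : nat, q.1 \is d.-homog /\ q.2 \is d.-homog) /\
  forall x : X, oset W x -> q.2.@[homcoord (val x)] != 0.

Variable A : comAlgType K.

(* Sections over U of O_X (x) A, the structure sheaf of X x Spec A, as functions
   from U to A: locally they are finite sums of p / q (x) a with p, q homogeneous
   of the same degree and q without zeros. Recall that X x Spec A and X have the
   same underlying space when A is a local Artinian algebra with residue field
   K. For A = K these are the regular functions, see regular_ratio below. *)
Definition is_regular (U : opens X) (f : U -> A) : Prop :=
  forall x : U, exists2 W : opens X, oset W (val x) &
  exists2 s : seq (({mpoly K[n.+1]} * {mpoly K[n.+1]}) * A),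
    forall t, t \in s -> is_ratio W t.1 &
    forall y : U, oset W (val y) -> f y = \sum_(t <- s) ratio t.1 (val y) *: t.2.

Section Sections.
Variable U : opens X.

Lemma regularP f g (x : U) : is_regular f -> is_regular g ->
  exists2 W : opens X, oset W (val x) &
  exists s s' : seq (({mpoly K[n.+1]} * {mpoly K[n.+1]}) * A),
    [/\ forall t, t \in s -> is_ratio W t.1, forall t, t \in s' -> is_ratio W t.1,
      forall y : U, oset W (val y) -> f y = \sum_(t <- s) ratio t.1 (val y) *: t.2 &
      forall y : U, oset W (val y) -> g y = \sum_(t <- s') ratio t.1 (val y) *: t.2].
Proof.
move=> /(_ x)[W Wx [s sW fs]] /(_ x)[W' W'x [s' sW' gs']].
exists (oI W W') => //; exists s, s'; split=> [t /sW|t /sW'|y|y].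
- by move=> [h hW]; split => // y [/hW].
- by move=> [h hW]; split => // y [_ /hW].
- by move=> [Wy _]; exact: fs.
- by move=> [_ Wy]; exact: gs'.
Qed.

Lemma regular_cst (a : A) : @is_regular U (fun=> a).
Proof.
move=> x; exists oT => //; exists [:: ((1, 1), a)].
  move=> t; rewrite inE => /eqP ->; split=> [|y _ /=]; last by rewrite meval1 oner_neq0.
  by exists 0%N; split; exact: dhomog1.
by move=> y _; rewrite big_seq1 /ratio /= meval1 divr1 scale1r.
Qed.

Definition regular_pred : {pred U -> A} := fun f => `[< is_regular f >].

Fact regular_subring : subring_closed regular_pred.
Proof.
split=> [|f g /asboolP rf /asboolP rg|f g /asboolP rf /asboolP rg].
- exact/asboolP/regular_cst.
- apply/asboolP => x; have [W Wx [s [s' [hs hs' fs gs']]]] := regularP x rf rg.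
  exists W => //; exists (s ++ [seq (t.1, - t.2) | t <- s']).
    move=> t; rewrite mem_cat => /orP[/hs //|/mapP[t' /hs' ? ->]] //.
  move=> y Wy; rewrite big_cat big_map /= -fs //; congr (_ + _).
  by rewrite -[LHS]/(- g y) (gs' y Wy) -sumrN; apply: eq_bigr => t _; rewrite scalerN.
- apply/asboolP => x; have [W Wx [s [s' [hs hs' fs gs']]]] := regularP x rf rg.
  exists W => //.
  exists [seq ((t.1.1 * t'.1.1, t.1.2 * t'.1.2), t.2 * t'.2) | t <- s, t' <- s'].
    move=> t /allpairsP[[t1 t2] /= [/hs[[d [d1 d2]] hW] /hs'[[d' [d1' d2']] hW'] ->]].
    split=> [|y Wy /=].
      by exists (d + d')%N; split; exact: dhomogM.
    by rewrite mevalM mulf_neq0 ?hW ?hW'.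
  move=> y Wy; rewrite big_allpairs_dep /= -[LHS]/(f y * g y) (fs y Wy) (gs' y Wy).
  rewrite mulr_suml; apply: eq_bigr => t _; rewrite mulr_sumr; apply: eq_bigr => t' _.
  by rewrite -scalerAl -scalerAr scalerA /ratio /= !mevalM mulf_div.
Qed.

Record regfun := RegFun { regfun_val :> U -> A; _ : regfun_val \in regular_pred }.
HB.instance Definition _ := [isSub for regfun_val].
HB.instance Definition _ := [Choice of regfun by <:].
HB.instance Definition _ := GRing.isSubringClosed.Build (U -> A) regular_pred regular_subring.
HB.instance Definition _ := GRing.SubChoice_isSubComPzRing.Build (U -> A) regular_pred regfun regular_subring.

Lemma regfunP (f : regfun) : is_regular f.
Proof. by case: f => f rf; exact/asboolP. Qed.

Definition mkRegFun (f : U -> A) (rf : is_regular f) : regfun := RegFun (asboolT rf).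
End Sections.

Lemma regfun_eq (U : opens X) (f g : regfun U) : (forall x, f x = g x) -> f = g.
Proof. by move=> e; apply: val_inj; apply/funext. Qed.

Definition incl (U V : opens X) (h : V `<=` U) (x : V) : U :=
  exist _ (val x) (mem_set (h _ (set_mem (valP x)))).

Lemma incl_regular (U V : opens X) (h : V `<=` U) (f : regfun U) :
  is_regular (f \o incl h).
Proof.
move=> x; have [W Wx [s sW fs]] := regfunP f (incl h x).
by exists W => //; exists s => // y Wy; rewrite /= fs.
Qed.

Definition regfun_res (U V : opens X) (h : V `<=` U) (f : regfun U) : regfun V :=
  mkRegFun (incl_regular h f).

Fact regfun_res_zmod U V h : zmod_morphism (@regfun_res U V h).
Proof. by move=> f g; apply: regfun_eq. Qed.
Fact regfun_res_monoid U V h : monoid_morphism (@regfun_res U V h).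
Proof. by split=> [|f g]; apply: regfun_eq. Qed.
HB.instance Definition _ U V h :=
  GRing.isZmodMorphism.Build _ _ (@regfun_res U V h) (@regfun_res_zmod U V h).
HB.instance Definition _ U V h :=
  GRing.isMonoidMorphism.Build _ _ (@regfun_res U V h) (@regfun_res_monoid U V h).

Lemma regfun_sheaf : is_sheaf regfun_res.
Proof.
split=> [U h f|U V W h1 h2 h3 f|I U V hV cov f fcompat].
- by apply: regfun_eq => x /=; congr (f _); exact: val_inj.
- by apply: regfun_eq => x /=; congr (f _); exact: val_inj.
have fE i j (x : V i) (y : V j) : val x = val y -> f i x = f j y.
  move=> exy.
  have Vx : oset (oI (V i) (V j)) (val x).
    by split; [exact: set_mem (valP x) | rewrite exy; exact: set_mem (valP y)].
  pose z : oI (V i) (V j) := exist _ (val x) (mem_set Vx).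
  have := congr1 (fun g : regfun (oI (V i) (V j)) => g z) (fcompat i j).
  rewrite /= (_ : incl _ z = x); last exact: val_inj.
  by rewrite (_ : incl _ z = y) //; exact: val_inj.
have covi (x : U) : exists i, oset (V i) (val x).
  by have [i _ Vx] := cov _ (set_mem (valP x)); exists i.
pose ix x := projT1 (cid (covi x)).
have ixP x : oset (V (ix x)) (val x) by rewrite /ix; case: cid.
pose g (x : U) : A := f (ix x) (exist _ (val x) (mem_set (ixP x))).
have gE i (x : V i) (y : U) : val x = val y -> g y = f i x.
  by move=> exy; apply: fE.
have g_reg : is_regular g.
  move=> x.
  have [W Wx [s sW fs]] := regfunP (f (ix x)) (exist _ (val x) (mem_set (ixP x))).
  exists (oI W (V (ix x))); first by split=> //; exact: ixP.
  exists s => [t /sW [h hW]|y [Wy Vy]]; first by split=> // z [/hW].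
  by rewrite (gE (ix x) (exist _ (val y) (mem_set Vy))) // fs.
exists (mkRegFun g_reg); split=> [i|g' g'P].
  by apply: regfun_eq => x /=; exact: gE.
apply: regfun_eq => x /=; rewrite /g -g'P /=; congr (g' _); exact: val_inj.
Qed.

Definition strSheaf : ringSheaf X := @RingSheaf X (fun U => regfun U)
  (fun U V h => @regfun_res U V h) regfun_sheaf.
Definition cstf (U : opens X) (a : A) : regfun U := mkRegFun (@regular_cst U a).

End StructureSheaf.

Lemma regular_ratio (K : fieldType) (n : nat) (X : set (projSpace K n))
    (U : opens X) (f : U -> K^o) :
  is_regular f <-> forall x : U, exists2 W : opens X, oset W (val x) &
    exists2 q, is_ratio W q & forall y : U, oset W (val y) -> f y = ratio q (val y).
Proof.
split=> rf x; have [W Wx] := rf x; last first.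
  move=> [q Wq fq]; exists W => //; exists [:: (q, 1)] => [t|y Wy].
    by rewrite inE => /eqP ->.
  by rewrite big_seq1 fq // -[RHS]/(_ * 1) mulr1.
move=> [s sW fs]; exists W => //.
suff [q Wq qs] : exists2 q, is_ratio W q &
    forall y, oset W y -> \sum_(t <- s) ratio t.1 y *: t.2 = ratio q y.
  by exists q => // y Wy; rewrite fs // qs.
elim: s sW {fs} => [_|[q c] s IH sW].
  exists (0, 1) => [|y _]; last by rewrite big_nil /ratio /= meval0 mul0r.
  split=> [|y _ /=]; last by rewrite meval1 oner_neq0.
  by exists 0%N; split; [exact: rpred0 | exact: dhomog1].
have [|q' [[d' [d1' d2']] W'] q's] := IH.
  by move=> t ts; apply: sW; rewrite inE ts orbT.
have [[d [d1 d2]] qW] : is_ratio W q by apply: (sW (q, c)); rewrite inE eqxx.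
exists (c *: (q.1 * q'.2) + q'.1 * q.2, q.2 * q'.2).
  split=> [|y Wy]; last by rewrite mevalM mulf_neq0 ?qW ?W'.
  exists (d + d')%N; split=> /=; last exact: dhomogM.
  by apply: rpredD; [apply/rpredZ/dhomogM | rewrite addnC; exact: dhomogM].
move=> y Wy; rewrite big_cons q's // /ratio /= mevalD mevalZ !mevalM.
have a0 := qW _ Wy; have b0 := W' _ Wy.
by rewrite -[_ *: c]/(_ / _ * c) (mulrAC _ _ c) addf_div // (mulrC c) (mulrAC _ _ c).
Qed.

Section CoefficientAlgebras.
Variable K : fieldType.

Definition is_ideal (A : comAlgType K) (J : set A) : Prop :=
  [/\ J 0, forall a b, J a -> J b -> J (a + b) & forall a b, J b -> J (a * b)].

Definition artinian (A : comAlgType K) : Prop :=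
  forall J : nat -> set A, (forall k, is_ideal (J k)) ->
    (forall k, J k.+1 `<=` J k) ->
    exists N, forall k, (N <= k)%N -> J k = J N.

(* Local Artinian K-algebras with residue field K: the maximal ideal is the
   kernel of the augmentation. *)
Record artAlg := ArtAlg {
  art_alg :> comAlgType K;
  art_aug : {lrmorphism art_alg -> K^o};
  art_local : forall a, art_aug a != 0 -> exists b, a * b = 1;
  art_dcc : artinian art_alg }.

Section SquareZero.
Variable V : lmodType K.

(* The square-zero extension K (+) V. *)
Definition sqz : Type := (K^o * V)%type.

HB.instance Definition _ := GRing.Lmodule.copy sqz (K^o * V)%type.

Definition sqz_one : sqz := (1, 0).
Definition sqz_mul (a b : sqz) : sqz := (a.1 * b.1, (a.1 : K) *: b.2 + (b.1 : K) *: a.2).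

Fact sqz_mulA : associative sqz_mul.
Proof.
move=> [a u] [b v] [c w]; congr (_, _) => /=; first by rewrite mulrA.
by rewrite !scalerDr !scalerA addrA (mulrC c a) (mulrC c b).
Qed.
Fact sqz_mulC : commutative sqz_mul.
Proof. by move=> [a u] [b v]; congr (_, _) => /=; [rewrite mulrC | rewrite addrC]. Qed.
Fact sqz_mul1 : left_id sqz_one sqz_mul.
Proof.
by move=> [a u]; congr (_, _) => /=; rewrite ?mul1r // scale1r scaler0 addr0.
Qed.
Fact sqz_mulDl : left_distributive sqz_mul +%R.
Proof.
move=> [a u] [b v] [c w]; congr (_, _) => /=; first by rewrite mulrDl.
by rewrite scalerDl scalerDr addrACA.
Qed.
Fact sqz_one_neq0 : sqz_one != 0.
Proof. by apply/eqP => -[] /eqP; rewrite oner_eq0. Qed.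

HB.instance Definition _ := GRing.Zmodule_isComNzRing.Build sqz
  sqz_mulA sqz_mulC sqz_mul1 sqz_mulDl sqz_one_neq0.

Fact sqz_scaleAl (k : K) (a b : sqz) : k *: (a * b) = (k *: a) * b.
Proof.
case: a b => [a u] [b v]; congr (_, _) => /=; first by rewrite scalerAl.
by rewrite scalerDr !scalerA (mulrC b k).
Qed.
HB.instance Definition _ := GRing.Lmodule_isLalgebra.Build K sqz sqz_scaleAl.
HB.instance Definition _ := GRing.Lalgebra_isComAlgebra.Build K sqz.

Definition sqz_aug (a : sqz) : K^o := a.1.
Fact sqz_aug_linear : linear sqz_aug. Proof. by []. Qed.
HB.instance Definition _ := GRing.isLinear.Build _ _ _ _ sqz_aug sqz_aug_linear.
Fact sqz_aug_monoid : monoid_morphism sqz_aug. Proof. by []. Qed.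
HB.instance Definition _ := GRing.isMonoidMorphism.Build _ _ sqz_aug sqz_aug_monoid.

Lemma sqz_local (a : sqz) : sqz_aug a != 0 -> exists b, a * b = 1.
Proof.
case: a => a u; rewrite /sqz_aug /= => a0.
exists (a^-1, - (a^-1 * a^-1) *: u); congr (_, _) => /=; first by rewrite mulfV.
by rewrite scaleNr scalerN scalerA mulrA mulfV // mul1r addNr.
Qed.
End SquareZero.

Section SquareZeroMap.
Variables (V W : lmodType K) (g : {linear V -> W}).
Definition sqz_map (a : sqz V) : sqz W := (a.1, g a.2).
Fact sqz_map_linear : linear sqz_map.
Proof. by move=> k a b; congr (_, _) => /=; rewrite linearP. Qed.
HB.instance Definition _ := GRing.isLinear.Build _ _ _ _ sqz_map sqz_map_linear.
Fact sqz_map_monoid : monoid_morphism sqz_map.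
Proof.
split; first by congr (_, _); rewrite /= linear0.
by move=> a b; congr (_, _) => /=; rewrite linearD !linearZZ.
Qed.
HB.instance Definition _ := GRing.isMonoidMorphism.Build _ _ sqz_map sqz_map_monoid.
End SquareZeroMap.

Lemma subspace_vspace (V : vectType K) (P : set V) : P 0 ->
  (forall k u v, P u -> P v -> P (k *: u + v)) ->
  exists W : {vspace V}, forall v, P v <-> v \in W.
Proof.
move=> P0 Plin.
pose Q (d : nat) : bool := `[< exists2 W : {vspace V}, \dim W = d & forall v, v \in W -> P v >].
have exQ : exists d, Q d.
  by exists 0%N; apply/asboolP; exists 0%VS; rewrite ?dimv0 // => v; rewrite memv0 => /eqP ->.
have bQ d : Q d -> (d <= dim V)%N.
  by move=> /asboolP[W <- _]; rewrite -dimvf dimvS // subvf.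
case: (ex_maxnP exQ bQ) => d /asboolP[W dW WP] maxd; exists W => v; split=> [Pv|/WP //].
apply: contrapT => /negP vW.
have /maxd : Q (\dim (W + <[v]>)%VS).
  apply/asboolP; exists (W + <[v]>)%VS => // w /memv_addP[w1 w1W [w2 /vlineP[k ->] ->]].
  by rewrite addrC; apply: Plin => //; exact: WP.
rewrite leqNgt -dW => /negP; apply.
rewrite dimv_disjoint_sum; last first.
  apply/eqP; rewrite -subv0; apply/subvP => w; rewrite memv_cap memv0.
  case/andP=> wW /vlineP[k ek]; apply: contraNT vW => w0.
  have k0 : k != 0 by apply: contraNneq w0 => k0; rewrite ek k0 scale0r.
  by rewrite -[v](scalerK k0) -ek memvZ.
rewrite dim_vline (_ : v != 0) ?addn1 //.
by apply: contraNneq vW => ->; rewrite mem0v.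
Qed.

Lemma sqz_dcc (V : vectType K) : artinian (sqz V).
Proof.
move=> J idJ decJ.
pose P k : set (K^o * V)%type := J k.
have exW k : exists W : {vspace (K^o * V)%type}, forall v, P k v <-> v \in W.
  have [J0 JD JM] := idJ k.
  apply: (@subspace_vspace (K^o * V)%type) => // c u v Ju Jv; apply: JD => //.
  by rewrite (_ : c *: u = (c%:A : sqz V) * u :> sqz V); [exact: JM | rewrite mulr_algl].
pose W k := projT1 (cid (exW k)).
have WP k v : P k v <-> v \in W k by rewrite /W; case: cid.
have Wdec k m : (k <= m)%N -> (W m <= W k)%VS.
  elim: m => [|m IH]; first by rewrite leqn0 => /eqP ->.
  rewrite leq_eqVlt => /orP[/eqP -> //|/IH]; apply: subv_trans.
  by apply/subvP => v /WP Jv; apply/WP; exact: decJ.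
pose Q (d : nat) : bool := `[< exists k, \dim (W k) = d >].
have exQ : exists d, Q d by exists (\dim (W 0%N)); apply/asboolP; exists 0%N.
case: (ex_minnP exQ) => d /asboolP[N dN] mind; exists N => k Nk.
have eW : W k = W N.
  by apply/eqP; rewrite eqEdim Wdec //= dN; apply: mind; apply/asboolP; exists k.
by apply/seteqP; split=> v /WP; rewrite ?eW => h; apply/WP; rewrite ?eW.
Qed.

Definition sqzArt (V : vectType K) : artAlg :=
  @ArtAlg (sqz V) (@sqz_aug V) (@sqz_local V) (@sqz_dcc V).
End CoefficientAlgebras.

Section Tensor.
Variables (K : fieldType) (U : lmodType K) (A : comAlgType K).

Definition bilinear_map (W : lmodType K) (beta : U -> A -> W) : Prop :=
  (forall u, linear (beta u)) /\ (forall a, linear (beta^~ a)).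

Definition tsum (W : lmodType K) (beta : U -> A -> W) (s : seq (U * A)) : W :=
  \sum_(t <- s) beta t.1 t.2.

(* The tensor product U (x)_K A, as an A-module: formal sums of pure tensors,
   identified when all bilinear maps agree on them. *)
Definition tensor_rel (s s' : seq (U * A)) : bool :=
  `[< forall (W : lmodType K) (beta : U -> A -> W), bilinear_map beta ->
        tsum beta s = tsum beta s' >].

Fact tensor_rel_equiv : equiv_class_of tensor_rel.
Proof.
split=> [s|s s'|s' s s'']; first exact/asboolP.
  by apply/asboolP/asboolP => h W b bb; rewrite h.
by move=> /asboolP h /asboolP h'; apply/asboolP => W b bb; rewrite h ?h'.
Qed.
Canonical tensor_equiv := EquivRelPack tensor_rel_equiv.

Definition tensor : Type := {eq_quot tensor_rel}%qT.
HB.instance Definition _ := Choice.on tensor.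
HB.instance Definition _ := EqQuotient.on tensor.

Definition tcls (s : seq (U * A)) : tensor := (\pi_tensor s)%qT.
Definition tpure (u : U) (a : A) : tensor := tcls [:: (u, a)].

Lemma tclsE s s' : tcls s = tcls s' <->
  forall (W : lmodType K) (beta : U -> A -> W), bilinear_map beta ->
    tsum beta s = tsum beta s'.
Proof. by split=> [/eqmodP/asboolP|h]; last exact/eqmodP/asboolP. Qed.

Lemma tclsP (x : tensor) : exists s, x = tcls s.
Proof. by exists (repr x); rewrite /tcls reprK. Qed.

Lemma trepr s (W : lmodType K) (beta : U -> A -> W) :
  bilinear_map beta -> tsum beta (repr (tcls s)) = tsum beta s.
Proof. by move: W beta; apply/tclsE; rewrite /tcls reprK. Qed.

Definition tscal (a : A) (s : seq (U * A)) := [seq (t.1, a * t.2) | t <- s].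
Definition topp (s : seq (U * A)) := [seq (t.1, - t.2) | t <- s].

Lemma tsum_cat (W : lmodType K) (b : U -> A -> W) s s' :
  tsum b (s ++ s') = tsum b s + tsum b s'.
Proof. exact: big_cat. Qed.
Lemma tsum_opp (W : lmodType K) (b : U -> A -> W) s :
  bilinear_map b -> tsum b (topp s) = - tsum b s.
Proof.
move=> [bl _]; rewrite /tsum big_map -sumrN; apply: eq_bigr => t _ /=.
pose f : {linear A -> W} := HB.pack (b t.1) (GRing.isLinear.Build _ _ _ _ _ (bl t.1)).
exact: (linearN f).
Qed.
Lemma tsum_scal (W : lmodType K) (b : U -> A -> W) a s :
  tsum b (tscal a s) = tsum (fun u c => b u (a * c)) s.
Proof. by rewrite /tsum big_map. Qed.
Lemma bilinear_scal (W : lmodType K) (b : U -> A -> W) a :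
  bilinear_map b -> bilinear_map (fun u c => b u (a * c)).
Proof.
move=> [bl br]; split=> [u k x y|c]; last exact: br.
by rewrite mulrDr -scalerAr bl.
Qed.

Definition tadd (x y : tensor) : tensor := tcls (repr x ++ repr y).
Definition tneg (x : tensor) : tensor := tcls (topp (repr x)).
Definition tscale (a : A) (x : tensor) : tensor := tcls (tscal a (repr x)).

Lemma taddE s s' : tadd (tcls s) (tcls s') = tcls (s ++ s').
Proof. by apply/tclsE => W b bb; rewrite !tsum_cat !trepr. Qed.
Lemma tnegE s : tneg (tcls s) = tcls (topp s).
Proof. by apply/tclsE => W b bb; rewrite !tsum_opp // trepr. Qed.
Lemma tscaleE a s : tscale a (tcls s) = tcls (tscal a s).
Proof.
by apply/tclsE => W b bb; rewrite !tsum_scal trepr //; exact: bilinear_scal.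
Qed.

Fact taddA : associative tadd.
Proof.
move=> x y z; have [s ->] := tclsP x; have [s' ->] := tclsP y.
by have [s'' ->] := tclsP z; rewrite !taddE catA.
Qed.
Fact taddC : commutative tadd.
Proof.
move=> x y; have [s ->] := tclsP x; have [s' ->] := tclsP y.
by rewrite !taddE; apply/tclsE => W b _; rewrite !tsum_cat addrC.
Qed.
Fact tadd0 : left_id (tcls [::]) tadd.
Proof. by move=> x; have [s ->] := tclsP x; rewrite taddE. Qed.
Fact taddN : left_inverse (tcls [::]) tneg tadd.
Proof.
move=> x; have [s ->] := tclsP x; rewrite tnegE taddE; apply/tclsE => W b bb.
by rewrite tsum_cat tsum_opp // addNr /tsum big_nil.
Qed.
HB.instance Definition _ := GRing.isZmodule.Build tensor taddA taddC tadd0 taddN.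

Fact tscaleA a b x : tscale a (tscale b x) = tscale (a * b) x.
Proof.
have [s ->] := tclsP x; rewrite !tscaleE; congr tcls.
by rewrite /tscal -map_comp; apply: eq_map => t /=; rewrite mulrA.
Qed.
Fact tscale1 : left_id 1 tscale.
Proof.
move=> x; have [s ->] := tclsP x; rewrite !tscaleE; congr tcls.
by rewrite -[RHS]map_id; apply: eq_map => -[u a] /=; rewrite mul1r.
Qed.
Fact tscaleDr : right_distributive tscale +%R.
Proof.
move=> a x y; have [s ->] := tclsP x; have [s' ->] := tclsP y.
by rewrite [tcls s + _]taddE !tscaleE [RHS]taddE /tscal map_cat.
Qed.
Fact tscaleDl x : {morph tscale^~ x : a b / a + b}.
Proof.
move=> a b; have [s ->] := tclsP x; rewrite !tscaleE [RHS]taddE.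
apply/tclsE => W f [fl _]; rewrite tsum_cat !tsum_scal /tsum -big_split /=.
apply: eq_bigr => t _; rewrite mulrDl.
pose g : {linear A -> W} := HB.pack (f t.1) (GRing.isLinear.Build _ _ _ _ _ (fl t.1)).
exact: (linearD g).
Qed.
HB.instance Definition _ := GRing.Zmodule_isLmodule.Build A tensor
  tscaleA tscale1 tscaleDr tscaleDl.

End Tensor.

Section LocallyFree.
Context {T : topologicalType} {R : ringSheaf T} (M : modSheaf R).

(* e identifies R^r|_U with M|_U. *)
Definition frame (U : opens T) (r : nat) (e : 'I_r -> M U) : Prop :=
  forall (V : opens T) (h : V `<=` U) (s : M V),
    exists! c : 'I_r -> R V, s = \sum_k c k *: mres h (e k).

Definition locally_free : Prop :=
  forall x : T, exists2 U : opens T, oset U x &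
    exists (r : nat) (e : 'I_r -> M U), frame e.
End LocallyFree.

Section SelfModule.
Context {T : topologicalType} (R : ringSheaf T).
Fact selfMod_sheaf : is_sheaf (fun U V (h : V `<=` U) => rres h : (R U)^o -> (R V)^o).
Proof. exact: (rsheaf R). Qed.
Definition selfMod : modSheaf R :=
  @ModSheaf T R (fun U => (R U)^o) (fun U V h => rres h)
    (fun U V h => rmorphD (rres h)) (fun U V h => rmorphM (rres h)) selfMod_sheaf.
End SelfModule.

Section Cup.
Context {T : topologicalType} {R : ringSheaf T} (E : modSheaf R).

Definition endSheaf : modSheaf R := homSheaf (idRSH R) E E.

Variable s : E oT.

(* The evaluation at a global section s induces a |-> a cup s. *)
Definition ev_fun (U : opens T) (f : endSheaf U) : E U :=
  homfun f (@subset_refl _ U) (mres (@subsetT _ U : U `<=` oT) s).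

Fact ev_res (U V : opens T) (h : V `<=` U) (f : endSheaf U) :
  ev_fun (mres h f) = mres h (ev_fun f).
Proof.
have [_ _ fr] := homP f; rewrite /ev_fun -(fr _ _ _ h) /=.
have [_ Ec _] := msheaf E.
by rewrite (Ec _ _ _ _ _ (@subsetT _ V : V `<=` oT)); congr (homfun f _ _); exact: Prop_irrelevance.
Qed.

Fact evZ (U : opens T) (a : R U) (f : endSheaf U) :
  ev_fun (a *: f) = a *: ev_fun f.
Proof.
rewrite /ev_fun /=; have [ri _ _] := rsheaf R; congr (_ *: _); exact: ri.
Qed.

Definition ev : modSheafHom (idRSH R) endSheaf E :=
  @ModSheafHom T R R (idRSH R) endSheaf E ev_fun (fun U f g => erefl) evZ ev_res.
End Cup.

Definition cup (T : topologicalType) (R : ringSheaf T) (E : modSheaf R)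
    (a : cechH (endSheaf E) 1) (s : E oT) : cechH E 1 := cechH_map (ev s) a.

Section Deformations.
Context {K : fieldType} {n : nat} (X : set (projSpace K n)).

Section StrHom.
Variables (A B : comAlgType K) (alpha : {lrmorphism A -> B}).

Lemma comp_regular (U : opens X) (f : regfun A U) : is_regular (alpha \o f).
Proof.
move=> x; have [W Wx [s sW fs]] := regfunP f x; exists W => //.
exists [seq (t.1, alpha t.2) | t <- s]; first by move=> t /mapP[t' /sW ? ->].
move=> y Wy; rewrite big_map /= fs // raddf_sum.
by apply: eq_bigr => t _; exact: (linearZZ alpha).
Qed.
Definition regfun_map (U : opens X) (f : regfun A U) : regfun B U :=
  mkRegFun (comp_regular f).

Fact regfun_map_zmod U : zmod_morphism (@regfun_map U).
Proof. by move=> f g; apply: regfun_eq => x; exact: (raddfB alpha). Qed.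
Fact regfun_map_monoid U : monoid_morphism (@regfun_map U).
Proof.
split=> [|f g]; apply: regfun_eq => x; first exact: (rmorph1 alpha).
exact: (rmorphM alpha).
Qed.
HB.instance Definition _ U :=
  GRing.isZmodMorphism.Build _ _ (@regfun_map U) (@regfun_map_zmod U).
HB.instance Definition _ U :=
  GRing.isMonoidMorphism.Build _ _ (@regfun_map U) (@regfun_map_monoid U).

Fact regfun_map_res (U V : opens X) (h : V `<=` U) (f : strSheaf X A U) :
  regfun_map (rres h f) = @rres _ (strSheaf X B) U V h (regfun_map f).
Proof. exact: regfun_eq. Qed.

Definition strHom : ringSheafHom (strSheaf X A) (strSheaf X B) :=
  @RingSheafHom _ (strSheaf X A) (strSheaf X B) regfun_map regfun_map_res.
End StrHom.

Definition unit_map (A : comAlgType K) (k : K^o) : A := k%:A.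
Fact unit_map_linear A : linear (@unit_map A).
Proof. by move=> k a b; rewrite /unit_map scalerDl -scalerA. Qed.
HB.instance Definition _ A := GRing.isLinear.Build _ _ _ _ (@unit_map A) (@unit_map_linear A).
Fact unit_map_monoid A : monoid_morphism (@unit_map A).
Proof.
by split=> [|a b]; rewrite /unit_map ?scale1r // -scalerAl mul1r scalerA.
Qed.
HB.instance Definition _ A :=
  GRing.isMonoidMorphism.Build _ _ (@unit_map A) (@unit_map_monoid A).

Definition gsec (A : comAlgType K) (M : modSheaf (strSheaf X A)) : Type := M oT.

Section GlobalSections.
Variables (A : comAlgType K) (M : modSheaf (strSheaf X A)).
HB.instance Definition _ := GRing.Zmodule.copy (gsec M) (M oT).
Definition gscale (a : A) (s : gsec M) : gsec M := (cstf (oT : opens X) a : strSheaf X A oT) *: (s : M oT).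
Fact cstfM (U : opens X) (a b : A) : cstf U (a * b) = cstf U a * cstf U b :> regfun A U.
Proof. exact: regfun_eq. Qed.
Fact cstfD (U : opens X) (a b : A) : cstf U (a + b) = cstf U a + cstf U b :> regfun A U.
Proof. exact: regfun_eq. Qed.
Fact cstf1 (U : opens X) : cstf U (1 : A) = 1 :> regfun A U.
Proof. exact: regfun_eq. Qed.
Fact gscaleA a b s : gscale a (gscale b s) = gscale (a * b) s.
Proof. by rewrite /gscale scalerA cstfM. Qed.
Fact gscale1 : left_id 1 gscale.
Proof. by move=> s; rewrite /gscale cstf1 scale1r. Qed.
Fact gscaleDr : right_distributive gscale +%R.
Proof. by move=> a s t; exact: scalerDr. Qed.
Fact gscaleDl s : {morph gscale^~ s : a b / a + b}.
Proof. by move=> a b; rewrite /gscale cstfD scalerDl. Qed.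
HB.instance Definition _ := GRing.Zmodule_isLmodule.Build A (gsec M)
  gscaleA gscale1 gscaleDr gscaleDl.
End GlobalSections.

Definition OX : ringSheaf X := strSheaf X K^o.

Definition H0 (E : modSheaf OX) : Type := E oT.
HB.instance Definition _ (E : modSheaf OX) := GRing.Zmodule.copy (H0 E) (E oT).
HB.instance Definition _ (E : modSheaf OX) := GRing.Zmodule_isLmodule.Build K (H0 E)
  (@gscaleA K^o E) (@gscale1 K^o E) (@gscaleDr K^o E) (@gscaleDl K^o E).

Section Reduction.
Variables (A : artAlg K) (M : modSheaf (strSheaf X A)) (E : modSheaf OX).

(* s belongs to m_A M(U). *)
Definition in_max_ideal (U : opens X) (s : M U) : Prop :=
  exists (r : nat) (m : 'I_r -> A) (t : 'I_r -> M U),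
    (forall k, art_aug A (m k) = 0) /\ s = \sum_k (cstf U (m k) : strSheaf X A U) *: t k.

(* pi induces an isomorphism of M (x)_A K = M / m_A M with E: it is an
   epimorphism of sheaves with kernel m_A M. *)
Definition is_reduction (pi : modSheafHom (strHom (art_aug A)) M E) : Prop :=
  (forall (U : opens X) (s : E U) (x : X), oset U x ->
     exists (V : opens X) (h : V `<=` U),
       oset V x /\ exists t : M V, pi V t = mres h s) /\
  (forall (U : opens X) (s : M U), pi U s = 0 <->
     forall x : X, oset U x -> exists (V : opens X) (h : V `<=` U),
       oset V x /\ in_max_ideal (mres h s)).
End Reduction.

Record deformation (A : artAlg K) (E : modSheaf OX) := Deformation {
  dfs :> modSheaf (strSheaf X A);
  dfs_lf : locally_free dfs;
  dfp : modSheafHom (strHom (art_aug A)) dfs E;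
  dfp_red : is_reduction dfp }.

(* U -> H^0(E) is the inclusion of the subspace of sections; the reduction
   U (x) A -> U maps u (x) a to aug(a) u. *)
Section Pairs.
Variables (E : modSheaf OX) (U : lmodType K) (i : {linear U -> H0 E}).

Record pair_deformation (A : artAlg K) := PairDeformation {
  pdef :> deformation A E;
  pdi : {linear tensor U A -> gsec pdef};
  pdiP : forall (u : U) (a : A),
    dfp pdef oT (pdi (tpure u a)) = i ((art_aug A a : K) *: u) }.

Definition pair_iso (A : artAlg K) (D D' : pair_deformation A) : Prop :=
  exists (phi : modSheafHom (idRSH (strSheaf X A)) D D')
         (psi : {linear tensor U A -> tensor U A}),
    [/\ forall V : opens X, bijective (phi V),
        forall (V : opens X) (s : dfs D V), dfp D' V (phi V s) = dfp D V s,
        bijective psi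
      & forall t, phi oT (pdi D t) = pdi D' (psi t)].

(* Isomorphism classes. *)
Definition Def (A : artAlg K) : Type :=
  {C : pair_deformation A -> Prop | exists D, C = pair_iso D}.

Definition Def_class (A : artAlg K) (D : pair_deformation A) : Def A :=
  exist _ (pair_iso D) (ex_intro _ D erefl).

(* The graph of Def(alpha): theta : E_A -> E_B is linear over alpha and compatible
   with the reductions. The induced map E_A (x)_A B -> E_B of locally free sheaves
   is then an isomorphism, being one modulo the nilpotent ideal m_B. *)
Definition Def_map (A B : artAlg K) (alpha : {lrmorphism A -> B})
    (xi : Def A) (eta : Def B) : Prop :=
  exists (D : pair_deformation A) (D' : pair_deformation B)
         (theta : modSheafHom (strHom alpha) D D'),
    [/\ xi = Def_class D, eta = Def_class D',
        forall (V : opens X) (s : dfs D V), dfp D' V (theta V s) = dfp D V s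
      & forall u a, theta oT (pdi D (tpure u a)) = pdi D' (tpure u (alpha a))].
End Pairs.

(* K[eps] and K[eps] x_K K[eps]. *)
Definition dual_numbers : artAlg K := sqzArt K^o.
Definition eps : dual_numbers := (0, 1).
Definition dual_numbers2 : artAlg K := sqzArt (K^o * K^o)%type.

(* The identification of first order deformations of E with H^1(End E).  On a
   fine enough cover pi has O_X-linear splittings sigma_x : E -> E_A, that is,
   trivialisations s + eps t |-> sigma_x s + eps (sigma_x t) of E_A; on overlaps
   they differ by the automorphism 1 + eps z_(x, y), and a is the class of z. *)
Definition kodaira_spencer (E : modSheaf OX) (D : deformation dual_numbers E)
    (a : cechH (endSheaf E) 1) : Prop :=
  exists2 z : cocycle (endSheaf E) 1, cls z = a &
  exists sigma : forall x : X, hom_on (strHom (@unit_map dual_numbers)) E D (coc_cover z x),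
    (forall (x : X) (V : opens X) (h : V `<=` coc_cover z x) (s : E V),
       dfp D V (homfun (sigma x) h s) = s) /\
    (forall (x : 'I_2 -> X) (V : opens X) (h : V `<=` ccap (coc_cover z) x)
       (h0 : V `<=` coc_cover z (x ord0)) (h1 : V `<=` coc_cover z (x ord_max)) (s : E V),
       homfun (sigma (x ord_max)) h1 s =
         homfun (sigma (x ord0)) h0 s +
         (cstf V eps : strSheaf X dual_numbers V) *:
           homfun (sigma (x ord0)) h0 (homfun (coc z x) h s)).

(* t_F = F(K[eps]) for F = Def_(E, H^0(E)). *)
Definition tangent_space (E : modSheaf OX) : Type :=
  Def (idfun : {linear H0 E -> H0 E}) dual_numbers.

(* The vector space structure of t_F: eps |-> c eps induces multiplication by
   c, and addition is F(K[eps] x_K K[eps]) = t_F x t_F followed by the map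
   induced by eps1, eps2 |-> eps. *)
Definition tscaled (E : modSheaf OX) (c : K) (xi eta : tangent_space E) : Prop :=
  Def_map (sqz_map (c \*: idfun : {linear K^o -> K^o}) : {lrmorphism dual_numbers -> dual_numbers}) xi eta.

Definition tsummed (E : modSheaf OX) (xi1 xi2 eta : tangent_space E) : Prop :=
  exists zeta : Def (idfun : {linear H0 E -> H0 E}) dual_numbers2,
    [/\ Def_map (sqz_map (fst : {linear (K^o * K^o)%type -> K^o}) : {lrmorphism dual_numbers2 -> dual_numbers}) zeta xi1,
        Def_map (sqz_map (snd : {linear (K^o * K^o)%type -> K^o}) : {lrmorphism dual_numbers2 -> dual_numbers}) zeta xi2
      & Def_map (sqz_map (fst \+ snd : {linear (K^o * K^o)%type -> K^o}) : {lrmorphism dual_numbers2 -> dual_numbers})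
          zeta eta].
End Deformations.

(* Main.v *)
(* Locally on X the reduction E_A -> E of a deformation over K[eps] has O_X-linear
   splittings sigma_x, and b |-> eps b' (b' any lift of b) identifies E with its kernel,
   injectively because E_A is locally free. So sigma_y - sigma_x = eps z_(x, y) for a
   cocycle z of End(E), unique up to the coboundaries coming from the choice of sigma;
   deformations with the same class are isomorphic by gluing
   sigma_x s + eps t |-> sigma'_x s + eps t, and every cocycle twists E (x) K[eps] into a
   deformation. A global section s of E lifts to E_A iff the cochain z s is a coboundary,
   that is iff a cup s = 0. Hence i_A exists iff a kills H^0(E), and a linear choice of
   lifts then gives one. Two choices of i_A differ by eps v with v an endomorphism of
   H^0(E), so they are related by an automorphism of H^0(E) (x) K[eps]. *)
From HB Require Import structures.
Require Import Defs.
From mathcomp Require Import all_boot all_order all_algebra.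
From mathcomp Require Import boolp classical_sets functions cardinality.
From mathcomp Require Import topology_structure subtype_topology.
From mathcomp Require Import mpoly.

Set Implicit Arguments.
Unset Strict Implicit.
Unset Printing Implicit Defensive.

Import GRing.Theory.

Local Open Scope classical_set_scope.
Local Open Scope ring_scope.

(** * Gluing in sheaves of modules *)

(** Only sections are ever glued, never sheaves. Morphisms are treated as sections of [homSheaf], so
    [emb] and the isomorphisms of deformations come from the sheaf property of Hom; the twisted
    deformation is written down at once as a sheaf of compatible families ([tw]). The inclusion of K
    in K[eps] makes E_A an O_X-module, and a is then the class of the extension 0 -> E -> E_A -> E
    -> 0 of O_X-modules. The K[eps]-structure is not lost: multiplication by eps is the reduction
    followed by [emb]. The operations on t_F are known only through graphs, that is, through maps
    theta of deformations over a map of coefficients. Linearity is therefore proved by pushing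
    splittings forward along an arbitrary theta compatible with the reductions. *)

Lemma choice_dep (I : Type) (F : I -> Type) (P : forall i, F i -> Prop) :
  (forall i, exists s, P i s) -> exists s : forall i, F i, forall i, P i (s i).
Proof. by move=> ex; exists (fun i => projT1 (cid (ex i))) => i; case: cid. Qed.

Lemma sub_oT (T : topologicalType) (U : opens T) : U `<=` oT.
Proof. exact: subsetT. Qed.
Arguments sub_oT {T} U [t] _.

Section SheafTheory.
Context {T : topologicalType} {R : ringSheaf T}.

Section Gluing.
Variable M : modSheaf R.

Lemma mres_id (U : opens T) (h : U `<=` U) (s : M U) : mres h s = s.
Proof. by have [e _ _] := msheaf M; exact: e. Qed.

Lemma mres_comp (U V W : opens T) (h1 : V `<=` U) (h2 : W `<=` V)
    (h3 : W `<=` U) (s : M U) : mres h2 (mres h1 s) = mres h3 s.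
Proof. by have [_ e _] := msheaf M; exact: e. Qed.

Lemma mres_irr (U V : opens T) (h k : V `<=` U) (s : M U) : mres h s = mres k s.
Proof. by congr (mres _ s); exact: Prop_irrelevance. Qed.

Lemma mresB (U V : opens T) (h : V `<=` U) : {morph @mres _ _ M U V h : s t / s - t}.
Proof. by move=> s t; rewrite mresD (@mresN _ _ M). Qed.

Lemma mres_sum (U V : opens T) (h : V `<=` U) (I : Type) (r : seq I) (F : I -> M U) :
  mres h (\sum_(i <- r) F i) = \sum_(i <- r) mres h (F i).
Proof. by rewrite (big_morph _ (mresD h) (@mres0 _ _ M _ _ h)). Qed.

(** The form of the sheaf axiom used throughout. A property that passes to restrictions and has at
    most one solution makes the chosen local solutions agree on overlaps, so no compatibility is
    left to check. Applied to [homSheaf] it glues morphisms. *)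
Lemma mres_glue (U : opens T) (P : forall V : opens T, V `<=` U -> M V -> Prop) :
  (forall (V W : opens T) (hV : V `<=` U) (hW : W `<=` U) (k : W `<=` V) s,
     P V hV s -> P W hW (mres k s)) ->
  (forall (V : opens T) (hV : V `<=` U) s t, P V hV s -> P V hV t -> s = t) ->
  (forall x, oset U x -> exists (V : opens T) (hV : V `<=` U),
     oset V x /\ exists s, P V hV s) ->
  exists s : M U, forall x, oset U x ->
    exists (V : opens T) (hV : V `<=` U), oset V x /\ P V hV (mres hV s).
Proof.
move=> Pres Puniq Pex.
pose I := {x | oset U x}.
have c1 (i : I) := cid (Pex _ (projT2 i)); pose V i := projT1 (c1 i).
have c2 i := cid (projT2 (c1 i)); pose hV i : V i `<=` U := projT1 (c2 i).
have Vx i : oset (V i) (projT1 i) := proj1 (projT2 (c2 i)).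
have /choice_dep[s sP] : forall i, exists s, P (V i) (hV i) s := fun i => proj2 (projT2 (c2 i)).
have [_ _ glue] := msheaf M.
have [|i j|t [tP _]] := glue I U V hV _ s.
- by move=> x Ux; exists (exist _ x Ux).
- have hi : oI (V i) (V j) `<=` U by move=> y [/hV].
  by apply: (Puniq _ hi); [exact: Pres (sP i) | exact: Pres (sP j)].
exists t => x Ux; exists (V (exist _ x Ux)), (hV _); split; first exact: Vx.
by rewrite tP.
Qed.

Lemma mres_sep (U : opens T) (s t : M U) :
  (forall x, oset U x -> exists (V : opens T) (h : V `<=` U),
     oset V x /\ mres h s = mres h t) -> s = t.
Proof.
move=> st.
pose I := {x | oset U x}.
have c1 (i : I) := cid (st _ (projT2 i)); pose V i := projT1 (c1 i).
have c2 i := cid (projT2 (c1 i)); pose h i : V i `<=` U := projT1 (c2 i).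
have Vx i : oset (V i) (projT1 i) := proj1 (projT2 (c2 i)).
have e i : mres (h i) s = mres (h i) t := proj2 (projT2 (c2 i)).
have [_ _ glue] := msheaf M.
have [|i j|u [_ uU]] := glue I U V h _ (fun i => mres (h i) s).
- by move=> x Ux; exists (exist _ x Ux) => //; exact: Vx.
- have k : oI (V i) (V j) `<=` U by move=> y [/h].
  by rewrite !(mres_comp _ _ k).
by rewrite -(uU s) // -(uU t).
Qed.
End Gluing.

Section HomFacts.
Context {S : ringSheaf T} (rho : ringSheafHom R S) (M : modSheaf R) (N : modSheaf S).

Lemma mhomB (f : modSheafHom rho M N) (U : opens T) : {morph f U : s t / s - t}.
Proof.
have f0 : f U 0 = 0 by apply: (addrI (f U 0)); rewrite -mhomD !addr0.
have fN s : f U (- s) = - f U s by apply: (addrI (f U s)); rewrite -mhomD !subrr.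
by move=> s t; rewrite mhomD fN.
Qed.

Lemma mhom00 (f : modSheafHom rho M N) (U : opens T) : f U 0 = 0.
Proof. by rewrite -(subrr 0) mhomB !subrr. Qed.

Lemma mhom_sum (f : modSheafHom rho M N) (U : opens T) (I : Type) (r : seq I)
  (F : I -> M U) : f U (\sum_(i <- r) F i) = \sum_(i <- r) f U (F i).
Proof. by rewrite (big_morph _ (@mhomD _ _ _ _ _ _ f U) (mhom00 f U)). Qed.

Variable U : opens T.
Implicit Types f : hom_on rho M N U.

Lemma homfunD f (V : opens T) (h : V `<=` U) : {morph f V h : s t / s + t}.
Proof. by have [] := homP f. Qed.
Lemma homfunZ f (V : opens T) (h : V `<=` U) a (s : M V) :
  f V h (a *: s) = rho V a *: f V h s.
Proof. by have [] := homP f. Qed.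
Lemma homfun_res f (V W : opens T) (hV : V `<=` U) (hW : W `<=` U) (h : W `<=` V) (s : M V) :
  f W hW (mres h s) = mres h (f V hV s).
Proof. by have [_ _] := homP f; exact. Qed.
Lemma homfun_irr f (V : opens T) (h k : V `<=` U) (s : M V) : f V h s = f V k s.
Proof. by congr (f V _ s); exact: Prop_irrelevance. Qed.
Lemma homfun0 f (V : opens T) (h : V `<=` U) : f V h 0 = 0.
Proof. by apply: (addrI (f V h 0)); rewrite -homfunD !addr0. Qed.
End HomFacts.

Fact hom_oT_res (S : ringSheaf T) (rho : ringSheafHom R S) (M : modSheaf R)
    (N : modSheaf S) (f : hom_on rho M N oT) (U V : opens T) (h : V `<=` U) (s : M U) :
  f V (sub_oT V) (mres h s) = mres h (f U (sub_oT U) s).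
Proof. exact: homfun_res. Qed.

Definition hom_oT (S : ringSheaf T) (rho : ringSheafHom R S) (M : modSheaf R)
    (N : modSheaf S) (f : hom_on rho M N oT) : modSheafHom rho M N :=
  @ModSheafHom _ _ _ rho M N (fun U => f U (sub_oT U))
    (fun U => homfunD f (sub_oT U)) (fun U a s => homfunZ f (sub_oT U) a s)
    (hom_oT_res f).
End SheafTheory.

(** * Local splittings of the reduction of a deformation *)

Section Deform.
Context {K : fieldType} {n : nat} (X : set (projSpace K n)).

(** Maps over this structure map are the O_X-linear maps into an A-linear sheaf, which is the
    linearity asked of splittings. *)
Definition unitHom (A : comAlgType K) : ringSheafHom (OX X) (strSheaf X A) :=
  strHom X (@unit_map K A).

Definition cst (A : comAlgType K) (V : opens X) (a : A) : strSheaf X A V := cstf V a.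

Lemma cst_res (A : comAlgType K) (U V : opens X) (h : V `<=` U) (a : A) :
  rres h (cst U a) = cst V a.
Proof. exact: regfun_eq. Qed.

Lemma strHom_cst (A B : comAlgType K) (alpha : {lrmorphism A -> B}) (V : opens X) (a : A) :
  strHom X alpha V (cst V a) = cst V (alpha a).
Proof. exact: regfun_eq. Qed.

Lemma aug_unitHom (A : artAlg K) (V : opens X) (f : OX X V) :
  strHom X (art_aug A) V (unitHom A V f) = f.
Proof.
apply: regfun_eq => x /=; rewrite /unit_map.
rewrite (linearZZ (art_aug A)) rmorph1; exact: mulr1.
Qed.

Section Splittings.
Variables (A : artAlg K) (E : modSheaf (OX X)) (D : deformation A E).
Hypothesis lfE : locally_free E.

Definition splits (U : opens X) (sigma : hom_on (unitHom A) E D U) : Prop :=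
  forall (V : opens X) (h : V `<=` U) (s : E V), dfp D V (sigma V h s) = s.

Lemma dfp_local_surj (U : opens X) (s : E U) (x : X) : oset U x ->
  exists (V : opens X) (h : V `<=` U), oset V x /\ exists t : D V, dfp D V t = mres h s.
Proof. by have [+ _] := dfp_red D; apply. Qed.

Lemma dfp_ker (U : opens X) (s : D U) : dfp D U s = 0 <->
     forall x : X, oset U x -> exists (V : opens X) (h : V `<=` U),
       oset V x /\ in_max_ideal (mres h s).
Proof. by have [_ +] := dfp_red D; apply. Qed.

Lemma dfp_local_lifts (U : opens X) (r : nat) (e : 'I_r -> E U) (x : X) : oset U x ->
  exists (V : opens X) (h : V `<=` U), oset V x /\
    exists t : 'I_r -> D V, forall k, dfp D V (t k) = mres h (e k).
Proof.
move=> Ux.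
have c1 k := cid (dfp_local_surj (e k) Ux); pose V k := projT1 (c1 k).
have c2 k := cid (projT2 (c1 k)); pose h k : V k `<=` U := projT1 (c2 k).
have Vx k : oset (V k) x := proj1 (projT2 (c2 k)).
have /choice_dep[t tP] : forall k, exists t, dfp D (V k) t = mres (h k) (e k) :=
  fun k => proj2 (projT2 (c2 k)).
pose W := oI U (ocap V).
have WV k : W `<=` V k by move=> y [_ /(_ k)].
exists W, (oIl U (ocap V)); split; first by split=> // k; exact: Vx.
exists (fun k => mres (WV k) (t k)) => k.
by rewrite mhom_res tP (mres_comp _ _ (oIl U (ocap V))).
Qed.

(** Lift a frame e_k of E to sections t_k of E_A and send sum c_k e_k to sum c_k t_k. Uniqueness of
    the coordinates makes this linear and compatible with restriction. *)
Lemma local_splitting (x : X) : exists U : opens X, oset U x /\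
  exists sigma : hom_on (unitHom A) E D U, splits sigma.
Proof.
have [U0 U0x [r [e fr]]] := lfE x.
have [U [hU [Ux [t tP]]]] := dfp_local_lifts e U0x.
exists U; split=> //.
have /choice_dep[c cP] (V : opens X) := choice_dep (fun h => choice_dep (fun s => fr V h s)).
pose k (V : opens X) (h : V `<=` U) : V `<=` U0 := subset_trans h hU.
have cE V h s : s = \sum_i c V h s i *: mres h (e i) by have [] := cP V h s.
have cU V h s (d : 'I_r -> OX X V) : s = \sum_i d i *: mres h (e i) -> c V h s = d.
  by have [_] := cP V h s; apply.
pose g (V : opens X) (h : V `<=` U) (s : E V) : D V :=
  \sum_i unitHom A V (c V (k V h) s i) *: mres h (t i).
have gP : is_hom (unitHom A) g.
  split=> [V h s s'|V h a s|V W hV hW h s].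
  - rewrite /g (cU _ _ _ (fun i => c V (k V h) s i + c V (k V h) s' i)).
      by rewrite -big_split; apply: eq_bigr => i _ /=; rewrite rmorphD scalerDl.
    rewrite {1}(cE _ (k V h) s) {1}(cE _ (k V h) s') -big_split.
    by apply: eq_bigr => i _; rewrite scalerDl.
  - rewrite /g (cU _ _ _ (fun i => a * c V (k V h) s i)).
      by rewrite scaler_sumr; apply: eq_bigr => i _; rewrite rmorphM scalerA.
    rewrite {1}(cE _ (k V h) s) scaler_sumr.
    by apply: eq_bigr => i _; rewrite scalerA.
  - rewrite /g (cU _ _ _ (fun i => rres h (c V (k V hV) s i))).
      rewrite mres_sum; apply: eq_bigr => i _.
      by rewrite mresZ (mres_comp _ _ hW) rhom_res.
    rewrite {1}(cE _ (k V hV) s) mres_sum; apply: eq_bigr => i _.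
    by rewrite mresZ (mres_comp _ _ (k W hW)).
exists (HomOn gP) => V h s /=; rewrite /g mhom_sum [RHS](cE _ (k V h) s).
apply: eq_bigr => i _; rewrite mhomZ mhom_res tP (mres_comp _ _ (k V h)).
by congr (_ *: _); exact: aug_unitHom.
Qed.
End Splittings.
End Deform.

(** * First order deformations: the sequence 0 -> E -> E_A -> E -> 0 *)

Section DualNumbers.
Context {K : fieldType} {n : nat} (X : set (projSpace K n)).
Notation DN := (@dual_numbers K).
Notation augH := (strHom X (art_aug DN)).
Notation unitH := (unitHom X DN).

Definition epsc (V : opens X) : strSheaf X DN V := cst V (@eps K : DN).

Lemma epsc_res (U V : opens X) (h : V `<=` U) : rres h (epsc U) = epsc V.
Proof. exact: cst_res. Qed.

Lemma regfunME (A : comAlgType K) (V : opens X) (f g : strSheaf X A V) x :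
  (f * g : regfun A V) x = (f : regfun A V) x * (g : regfun A V) x.
Proof. by []. Qed.

Lemma epsM (a : DN) : (@eps K : DN) * a = (0, a.1).
Proof.
rewrite -[LHS]/(sqz_mul (@eps K) a) /sqz_mul /= mul0r scale0r add0r.
by congr (_, _); exact: mulr1.
Qed.

Lemma epsc2 (V : opens X) : epsc V * epsc V = 0.
Proof. by apply: regfun_eq => x; rewrite regfunME epsM. Qed.

Lemma epsc_ker (V : opens X) (f : strSheaf X DN V) : epsc V * f = 0 -> augH V f = 0.
Proof.
move=> e; apply: regfun_eq => x /=.
have : (epsc V * f : regfun DN V) x = 0 by rewrite e.
by rewrite regfunME epsM => -[].
Qed.

Lemma aug0_eps (V : opens X) (m : DN) : art_aug DN m = 0 ->
  cst V m = epsc V * cst V ((m.2 : K)%:A : DN).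
Proof.
case: m => m0 m1 /= m00; apply: regfun_eq => x; rewrite regfunME epsM /=.
by congr (_, _); [exact: m00 | rewrite [RHS]mulr1].
Qed.

Section EpsEmbedding.
Variables (E : modSheaf (OX X)) (D : deformation DN E).
Hypothesis lfE : locally_free E.

Lemma in_max_idealE (V : opens X) (s : D V) :
  in_max_ideal s -> exists t : D V, s = epsc V *: t.
Proof.
move=> [r [m [t [m0 ->]]]].
exists (\sum_k cst V (((m k).2 : K)%:A : DN) *: t k); rewrite scaler_sumr.
by apply: eq_bigr => k _; rewrite scalerA -aug0_eps.
Qed.

Lemma dfp_eps (V : opens X) (s : D V) : dfp D V (epsc V *: s) = 0.
Proof.
by rewrite mhomZ (_ : augH V (epsc V) = 0) ?scale0r //; exact: regfun_eq.
Qed.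

Lemma dfp_ker_local (U : opens X) (s : D U) : dfp D U s = 0 ->
  forall x : X, oset U x -> exists (V : opens X) (h : V `<=` U),
       oset V x /\ exists t : D V, mres h s = epsc V *: t.
Proof.
move=> /dfp_ker + x Ux => /(_ x Ux)[V [h [Vx /in_max_idealE st]]].
by exists V, h.
Qed.

Lemma eps_dfp0 (U : opens X) (s : D U) : dfp D U s = 0 -> epsc U *: s = 0.
Proof.
move=> s0; apply: mres_sep => x Ux.
have [V [h [Vx [t e]]]] := dfp_ker_local s0 Ux.
exists V, h; split=> //.
by rewrite mresZ e epsc_res scalerA epsc2 scale0r (@mres0 _ _ D).
Qed.

(* Flatness of D enters here, through local frames. *)
Lemma dfp_eps0 (U : opens X) (s : D U) : epsc U *: s = 0 -> dfp D U s = 0.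
Proof.
move=> s0; apply: mres_sep => x Ux.
have [V Vx [r [e fr]]] := dfs_lf D x.
exists (oI U V), (oIl U V); split=> //.
rewrite (@mres0 _ _ E) -mhom_res.
have [c [cE _]] := fr _ (oIr U V) (mres (oIl U V) s).
have [d [_ dU]] := fr _ (oIr U V) 0.
have d0 : d = fun=> 0.
  by apply: dU; rewrite big1 // => k _; rewrite scale0r.
(* Uniqueness of the coordinates of the zero section turns the vanishing of eps s into eps c_k = 0
   for each k, so every c_k has zero augmentation. *)
have ec : (fun k => epsc _ * c k) = fun=> 0.
  rewrite -d0; apply/esym/dU.
  under eq_bigr => k _ do rewrite -scalerA.
  by rewrite -scaler_sumr -cE -(epsc_res (oIl U V)) -mresZ s0 (@mres0 _ _ D).
rewrite cE mhom_sum big1 // => k _; rewrite mhomZ epsc_ker ?scale0r //.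
by have := congr1 (@^~ k) ec.
Qed.

(** Locally eps sigma is such a map, for any splitting sigma. The condition determines the map,
    because the reduction is locally surjective; hence the choices of sigma do not matter and the
    local maps glue. *)
Lemma eps_embedding_exists : exists j : modSheafHom unitH E D,
  forall (V : opens X) (t : D V), j V (dfp D V t) = epsc V *: t.
Proof.
pose P (V : opens X) (_ : V `<=` oT) (f : homSheaf unitH E D V) : Prop :=
  forall (W : opens X) (k : W `<=` V) (t : D W), homfun f k (dfp D W t) = epsc W *: t.
have [|V hV f g fP gP|x _|j jP] := @mres_glue _ _ (homSheaf unitH E D) oT P.
- by move=> V W hV hW k f fP W' k' t; exact: fP.
- apply: hom_onP => W k b; apply: mres_sep => x Wx.
  have [W' [h [W'x [t tb]]]] := dfp_local_surj D b Wx.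
  exists W', h; split=> //.
  by rewrite -!(homfun_res _ _ (subset_trans h k)) -tb fP gP.
- have [U [Ux [sigma sP]]] := local_splitting D lfE x.
  exists U, (sub_oT U); split=> //.
  (* Both t and sigma of its reduction have the same reduction, and eps kills the kernel of the
     reduction. *)
  exists (epsc U *: sigma : hom_on unitH E D U) => W k t /=.
  rewrite epsc_res; apply/eqP; rewrite -subr_eq0 -scalerBr; apply/eqP/eps_dfp0.
  by rewrite mhomB sP subrr.
exists (hom_oT j) => V t /=; apply: mres_sep => x Vx.
have [W [hW [Wx Pj]]] := jP x I.
exists (oI V W), (oIl V W); split=> //.
rewrite -(homfun_res _ _ (sub_oT (oI V W))) -mhom_res mresZ epsc_res -(Pj _ (oIr V W)).
by rewrite /=; exact: homfun_irr.
Qed.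

(* The map b |-> eps b' for any local lift b' of b. *)
Definition emb : modSheafHom unitH E D := projT1 (cid eps_embedding_exists).

Lemma emb_dfp (V : opens X) (t : D V) : emb V (dfp D V t) = epsc V *: t.
Proof. by rewrite /emb; case: cid. Qed.

Lemma dfp_emb (V : opens X) (b : E V) : dfp D V (emb V b) = 0.
Proof.
apply: mres_sep => x Vx; have [W [h [Wx [t tb]]]] := dfp_local_surj D b Vx.
exists W, h; split=> //.
by rewrite -!mhom_res -tb emb_dfp dfp_eps (@mres0 _ _ E).
Qed.

Lemma eps_emb (V : opens X) (b : E V) : epsc V *: emb V b = 0.
Proof. by rewrite -emb_dfp dfp_emb mhom00. Qed.

Lemma emb_inj0 (V : opens X) (b : E V) : emb V b = 0 -> b = 0.
Proof.
move=> b0; apply: mres_sep => x Vx; have [W [h [Wx [t tb]]]] := dfp_local_surj D b Vx.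
exists W, h; split=> //; rewrite -tb (@mres0 _ _ E); apply: dfp_eps0.
by rewrite -emb_dfp tb mhom_res b0 (@mres0 _ _ D).
Qed.

Lemma emb_inj (V : opens X) : injective (emb V).
Proof.
move=> a b e; apply/eqP; rewrite -subr_eq0; apply/eqP/emb_inj0.
by rewrite mhomB e subrr.
Qed.

(** Exactness in the middle holds on sections over every open, not only on stalks: the local
    preimages glue because [emb] is injective. *)
Lemma dfp_ker_emb (V : opens X) (s : D V) : dfp D V s = 0 -> exists b, s = emb V b.
Proof.
move=> s0.
have [|W hW a b|x Vx|b bP] :=
    @mres_glue _ _ E V (fun W h b => mres h s = emb W b).
- by move=> W W' hW hW' k b e; rewrite mhom_res -e (mres_comp _ _ hW').
- by move=> ->; exact: emb_inj.
- have [W [h [Wx [t e]]]] := dfp_ker_local s0 Vx.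
  by exists W, h; split=> //; exists (dfp D W t); rewrite emb_dfp.
exists b; apply: mres_sep => x Vx; have [W [h [Wx e]]] := bP x Vx.
by exists W, h; split=> //; rewrite e -mhom_res.
Qed.

(** Left exactness of Hom(E, -). It turns the difference of two splittings into an endomorphism of
    E. *)
Lemma hom_ker_emb (U : opens X) (f : hom_on unitH E D U) :
  (forall (V : opens X) (h : V `<=` U) (s : E V), dfp D V (f V h s) = 0) ->
  exists g : endSheaf E U, forall (V : opens X) (h : V `<=` U) (s : E V),
    f V h s = emb V (homfun g h s).
Proof.
move=> f0.
have /choice_dep[g gP] (V : opens X) :=
  choice_dep (fun h => choice_dep (fun s => dfp_ker_emb (f0 V h s))).
have gh : is_hom (idRSH (OX X)) g.
  split=> [V h s t|V h a s|V W hV hW h s]; apply: emb_inj.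
  - by rewrite mhomD -!gP homfunD.
  - by rewrite mhomZ -!gP homfunZ.
  - by rewrite mhom_res -!gP (homfun_res _ hV).
by exists (HomOn gh).
Qed.
End EpsEmbedding.
End DualNumbers.

(** * The Kodaira-Spencer class *)

Section Composition.
Context {T : topologicalType} {R1 R2 R3 : ringSheaf T}.
Variables (rho1 : ringSheafHom R1 R2) (rho2 : ringSheafHom R2 R3) (rho3 : ringSheafHom R1 R3).
Hypothesis rho3E : forall (V : opens T) f, rho2 V (rho1 V f) = rho3 V f.
Variables (M1 : modSheaf R1) (M2 : modSheaf R2) (M3 : modSheaf R3).
Variable theta : modSheafHom rho2 M2 M3.

Fact comp_hom_subproof (U : opens T) (g : hom_on rho1 M1 M2 U) :
  is_hom rho3 (fun (V : opens T) (h : V `<=` U) (s : M1 V) => theta V (g V h s)).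
Proof.
split=> [V h s t|V h a s|V W hV hW h s].
- by rewrite homfunD mhomD.
- by rewrite homfunZ mhomZ rho3E.
- by rewrite (homfun_res _ hV) mhom_res.
Qed.
Definition comp_hom (U : opens T) (g : hom_on rho1 M1 M2 U) : hom_on rho3 M1 M3 U :=
  HomOn (comp_hom_subproof g).

Variable phi : modSheafHom rho1 M1 M2.
Fact comp_mhomD (U : opens T) : {morph (fun s : M1 U => theta U (phi U s)) : s t / s + t}.
Proof. by move=> s t /=; rewrite !mhomD. Qed.
Fact comp_mhomZ (U : opens T) (f : R1 U) (s : M1 U) :
  theta U (phi U (f *: s)) = rho3 U f *: theta U (phi U s).
Proof. by rewrite !mhomZ rho3E. Qed.
Fact comp_mhom_res (U V : opens T) (h : V `<=` U) (s : M1 U) :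
  theta V (phi V (mres h s)) = mres h (theta U (phi U s)).
Proof. by rewrite !mhom_res. Qed.
Definition comp_mhom : modSheafHom rho3 M1 M3 :=
  @ModSheafHom _ _ _ rho3 M1 M3 (fun U s => theta U (phi U s))
    comp_mhomD comp_mhomZ comp_mhom_res.
End Composition.

Section LowDegreeCochains.
Context {T : topologicalType} {R : ringSheaf T} (M : modSheaf R) (U : @pcover T).

Lemma ccap_pt (x : T) : U x `<=` ccap U (fun _ : 'I_1 => x).
Proof. by move=> y Uy k. Qed.

Lemma ccap_le p (x : 'I_p -> T) (k : 'I_p) : ccap U x `<=` U (x k).
Proof. by move=> y; apply. Qed.

(** Indices of cochains are functions, and a face of a tuple often equals the wanted tuple only
    pointwise, so that the two values have different types. Comparing them after restriction to a
    common open avoids a cast. *)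
Lemma cochain_mres p (b : cochain M U p) (x y : 'I_p.+1 -> T) (V : opens T)
  (h : V `<=` ccap U x) (k : V `<=` ccap U y) : x =1 y -> mres h (b x) = mres k (b y).
Proof. by move/funext => e; subst y; exact: mres_irr. Qed.

Lemma delta0E (b : cochain M U 0) (x : 'I_2 -> T) :
  delta b x = mres (subset_trans (@ccap_le _ x ord_max) (@ccap_pt (x ord_max))) (b (fun=> x ord_max))
            - mres (subset_trans (@ccap_le _ x ord0) (@ccap_pt (x ord0))) (b (fun=> x ord0)).
Proof.
rewrite /delta !big_ord_recl big_ord0 addr0 expr0 scale1r expr1 scaleN1r.
by congr (_ - _); apply: cochain_mres => j; congr x; apply: val_inj; rewrite (ord1 j).
Qed.

Lemma delta1E (b : cochain M U 1) (x : 'I_3 -> T) :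
  delta b x = mres (@ccap_face _ U _ x ord0) (b (fun j => x (lift ord0 j)))
     - mres (@ccap_face _ U _ x (lift ord0 ord0)) (b (fun j => x (lift (lift ord0 ord0) j)))
     + mres (@ccap_face _ U _ x ord_max) (b (fun j => x (lift ord_max j))).
Proof.
rewrite /delta !big_ord_recl big_ord0 addr0 expr0 scale1r expr1 scaleN1r.
rewrite -addrA; congr (_ + (_ + _)).
rewrite /bump /= sqrrN expr1n scale1r.
by apply: cochain_mres => j; congr x; congr lift; apply: val_inj.
Qed.

End LowDegreeCochains.

Section KodairaSpencer.
Context {K : fieldType} {n : nat} (X : set (projSpace K n)).
Notation DN := (@dual_numbers K).
Notation unitH := (unitHom X DN).
Variables (E : modSheaf (OX X)) (lfE : locally_free E).

Section Families.
Variables (D : deformation DN E).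
Notation emb := (emb D lfE).

Definition ks_family (U : @pcover X) (z : cochain (endSheaf E) U 1)
    (sigma : forall x : X, hom_on unitH E D (U x)) : Prop :=
  (forall x, splits (sigma x)) /\
  forall (x : 'I_2 -> X) (V : opens X) (h : V `<=` ccap U x)
    (h0 : V `<=` U (x ord0)) (h1 : V `<=` U (x ord_max)) (s : E V),
    sigma (x ord_max) V h1 s = sigma (x ord0) V h0 s + emb V (homfun (z x) h s).

Lemma kodaira_spencerE (a : cechH (endSheaf E) 1) : kodaira_spencer D a <->
  exists2 z : cocycle (endSheaf E) 1, cls z = a &
    exists sigma, ks_family (coc z) sigma.
Proof.
have e (U : opens X) (sigma : hom_on unitH E D U) : splits sigma ->
    forall (V : opens X) (h : V `<=` U) (t : E V),
      epsc V *: sigma V h t = emb V t.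
  by move=> sP V h t; rewrite -emb_dfp sP.
split=> -[z za [sigma [sP zP]]]; exists z => //; exists sigma; split=> //.
  by move=> x V h h0 h1 s; rewrite zP; congr (_ + _); exact: (e _ _ (sP _)).
by move=> x V h h0 h1 s; rewrite zP; congr (_ + _); exact/esym/(e _ _ (sP _)).
Qed.

Lemma ks_family_uniq (U : @pcover X) (z z' : cochain (endSheaf E) U 1) sigma :
  ks_family z sigma -> ks_family z' sigma -> z = z'.
Proof.
move=> [_ h] [_ h']; apply: cochainP => x; apply: hom_onP => V k s.
apply: (@emb_inj _ _ _ _ D lfE); apply: (addrI (sigma (x ord0) V (subset_trans k (@ccap_le _ U _ x ord0)) s)).
rewrite -(h _ _ _ _ (subset_trans k (@ccap_le _ U _ x ord_max))); exact: h'.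
Qed.

Lemma ks_family_delta (U : @pcover X) (z : cochain (endSheaf E) U 1) sigma :
  ks_family z sigma -> delta z = 0.
Proof.
move=> [_ zP]; apply: cochainP => x; rewrite delta1E; apply: hom_onP => V k s.
apply: (@emb_inj _ _ _ _ D lfE).
pose k' i : V `<=` U (x i) := subset_trans k (@ccap_le _ U _ x i).
have zE i : emb V (homfun (mres (@ccap_face _ U _ x i) (z (fun j => x (lift i j)))) k s)
    = sigma (x (lift i ord_max)) V (k' _) s - sigma (x (lift i ord0)) V (k' _) s.
  rewrite (zP (fun j => x (lift i j)) V (subset_trans k (@ccap_face _ U _ x i)) (k' _)).
  by rewrite addrC addKr.
rewrite /= in zE.
rewrite (_ : homfun _ k s =
    homfun (mres (@ccap_face _ U _ x ord0) (z (fun j => x (lift ord0 j)))) k s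
  - homfun (mres (@ccap_face _ U _ x (lift ord0 ord0)) (z (fun j => x (lift (lift ord0 ord0) j)))) k s
  + homfun (mres (@ccap_face _ U _ x ord_max) (z (fun j => x (lift ord_max j)))) k s) //.
rewrite mhomD mhomB mhom00 !zE.
(* The vertices of the three faces of a triangle; after [emb] each face is a difference of two
   splittings, and the six terms cancel in pairs. *)
have i1 : lift (lift ord0 ord0) ord0 = ord0 :> 'I_3 by exact: val_inj.
have i2 : lift (lift ord0 ord0) ord_max = ord_max :> 'I_3 by exact: val_inj.
have i3 : lift ord_max ord0 = ord0 :> 'I_3 by exact: val_inj.
have i4 : lift ord0 ord_max = ord_max :> 'I_3 by exact: val_inj.
have i5 : lift ord_max ord_max = lift ord0 ord0 :> 'I_3 by exact: val_inj.
by rewrite i1 i2 i3 i4 i5 opprB [X in X + _]addrC !subrKA subrr.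
Qed.

Lemma ks_family_res (U W : @pcover X) (h : finer W U) (z : cochain (endSheaf E) U 1) sigma :
  ks_family z sigma -> ks_family (cres h z) (fun x => hom_res (h x) (sigma x)).
Proof.
move=> [sP zP]; split=> [x V k s|x V k k0 k1 s]; first exact: sP.
exact: (zP x V (subset_trans k (@ccap_finer _ _ _ h _ x))).
Qed.

Definition emb_hom (U : opens X) (b : endSheaf E U) : hom_on unitH E D U :=
  @comp_hom _ _ _ _ (idRSH (OX X)) unitH unitH (fun _ _ => erefl) _ _ _ emb U b.

(** Splittings over a cover form a torsor under the 0-cochains of End(E), by this lemma and
    [ks_family_sub]. This is how a coboundary is absorbed into the choice of splittings. *)
Lemma ks_family_add (U : @pcover X) (z : cochain (endSheaf E) U 1) sigma
    (b : cochain (endSheaf E) U 0) : ks_family z sigma ->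
  ks_family (z + delta b)
    (fun x => sigma x + emb_hom (mres (@ccap_pt _ U x) (b (fun=> x)))).
Proof.
move=> [sP zP]; split=> [x V k s|x V k k0 k1 s].
  by rewrite /= mhomD sP dfp_emb addr0.
rewrite cochainDE delta0E /= (zP _ _ k k0) -!addrA -!mhomD; congr (_ + emb V _).
rewrite addrCA; congr (_ + _).
rewrite [X in _ + (_ - X)](homfun_irr _ _ (subset_trans k0 (@ccap_pt _ U (x ord0)))).
by rewrite addrCA subrr addr0; exact: homfun_irr.
Qed.

Lemma ks_family_sub (U : @pcover X) (sigma tau : forall x : X, hom_on unitH E D (U x)) :
  (forall x, splits (sigma x)) -> (forall x, splits (tau x)) ->
  exists b : cochain (endSheaf E) U 0, forall x,
    tau x = sigma x + emb_hom (mres (@ccap_pt _ U x) (b (fun=> x))).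
Proof.
move=> sP tP.
have /choice_dep[b bP] (x : X) : exists b : endSheaf E (U x), tau x = sigma x + emb_hom b.
  have [|b bP] := @hom_ker_emb _ _ _ _ D lfE (U x) (tau x - sigma x).
    by move=> V h s; rewrite [_ V h s]/= mhomB sP tP subrr.
  by exists b; apply: hom_onP => V h s /=; rewrite -bP /= addrC subrK.
exists (fun y => mres (@ccap_le _ U _ y ord0) (b (y ord0))) => x.
by rewrite bP (mres_comp _ _ (@subset_refl _ _)) mres_id.
Qed.

Lemma ks_family_exists (U : @pcover X) (sigma : forall x : X, hom_on unitH E D (U x)) :
  (forall x, splits (sigma x)) -> exists z : cochain (endSheaf E) U 1, ks_family z sigma.
Proof.
move=> sP.
have /choice_dep[z zP] (x : 'I_2 -> X) : exists z : endSheaf E (ccap U x),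
    forall (V : opens X) (h : V `<=` ccap U x) (h0 : V `<=` U (x ord0)) (h1 : V `<=` U (x ord_max)) (s : E V),
    sigma (x ord_max) V h1 s = sigma (x ord0) V h0 s + emb V (homfun z h s).
  have [|z zP] := @hom_ker_emb _ _ _ _ D lfE (ccap U x)
     (hom_res (@ccap_le _ U _ x ord_max) (sigma (x ord_max))
      - hom_res (@ccap_le _ U _ x ord0) (sigma (x ord0))).
    by move=> V h s; rewrite [_ V h s]/= mhomB !sP subrr.
  exists z => V h h0 h1 s; rewrite -zP /= addrC (homfun_irr _ _ h1).
  by rewrite (homfun_irr (sigma (x ord0)) _ h0) subrK.
by exists z.
Qed.
End Families.
End KodairaSpencer.

Section KodairaSpencerClass.
Context {K : fieldType} {n : nat} (X : set (projSpace K n)).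
Notation DN := (@dual_numbers K).
Notation unitH := (unitHom X DN).
Variables (E : modSheaf (OX X)) (lfE : locally_free E).

Lemma splitting_cover (A : artAlg K) (D : deformation A E) :
  exists (U : @pcover X) (sigma : forall x : X, hom_on (unitHom X A) E D (U x)),
    forall x, splits (sigma x).
Proof.
have c (x : X) := cid (local_splitting D lfE x).
pose U := @Cover X (fun x => projT1 (c x)) (fun x => proj1 (projT2 (c x))).
have /choice_dep[sigma sP] (x : X) : exists sigma, @splits _ _ _ _ _ D (U x) sigma.
  exact: proj2 (projT2 (c x)).
by exists U, sigma.
Qed.

Lemma ks_family_class (D : deformation DN E) (U : @pcover X)
    (sigma : forall x : X, hom_on unitH E D (U x)) :
  (forall x, splits (sigma x)) ->
  exists z : cochain (endSheaf E) U 1, ks_family lfE z sigma /\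
    exists dz : delta z = 0, kodaira_spencer D (cls (Cocycle dz)).
Proof.
move=> /(ks_family_exists lfE)[z zP]; exists z; split=> //.
by exists (ks_family_delta zP); apply/(kodaira_spencerE lfE); exists (Cocycle (ks_family_delta zP)) => //; exists sigma.
Qed.

Lemma kodaira_spencer_exists (D : deformation DN E) : exists a, kodaira_spencer D a.
Proof.
have [U [sigma /ks_family_class[z [_ [dz ?]]]]] := splitting_cover D.
by exists (cls (Cocycle dz)).
Qed.

Lemma kodaira_spencer_uniq (D : deformation DN E) a a' :
  kodaira_spencer D a -> kodaira_spencer D a' -> a = a'.
Proof.
move=> /(kodaira_spencerE lfE)[z <- [sigma sP]] /(kodaira_spencerE lfE)[w <- [tau tP]].
apply/esym/clsE.
pose hl := @meet_finerl _ (coc_cover w) (coc_cover z).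
pose hr := @meet_finerr _ (coc_cover w) (coc_cover z).
have sP' := ks_family_res hr sP; have tP' := ks_family_res hl tP.
have [b bP] := @ks_family_sub _ _ _ _ lfE _ _ _ _ (proj1 sP') (proj1 tP').
exists (meet_cover (coc_cover w) (coc_cover z)), hl, hr; exists b.
have := ks_family_add b sP'.
rewrite -(functional_extensionality_dep bP) => /(ks_family_uniq tP') ->.
by rewrite addrC addKr.
Qed.

Section Transport.
Variable rho : ringSheafHom (strSheaf X DN) (strSheaf X DN).
Hypothesis rho_unit : forall (V : opens X) f, rho V (unitH V f) = unitH V f.
Variable c : K.
Hypothesis rho_eps : forall V : opens X, rho V (epsc V) = unitH V (cst V (c : K^o)) * epsc V.
Variables (D D' : deformation DN E) (theta : modSheafHom rho D D').
Hypothesis thetaP : forall (V : opens X) (s : D V), dfp D' V (theta V s) = dfp D V s.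

Lemma theta_emb (V : opens X) (b : E V) :
  theta V (emb D lfE V b) = emb D' lfE V (cst V (c : K^o) *: b).
Proof.
apply: mres_sep => x Vx; have [W [h [Wx [t tb]]]] := dfp_local_surj D b Vx.
exists W, h; split=> //.
rewrite -!mhom_res mresZ -tb emb_dfp mhomZ rho_eps cst_res.
by rewrite -thetaP mhomZ emb_dfp scalerA.
Qed.

(** [theta] carries splittings to splittings and [emb] to c times [emb], so it multiplies the
    cocycle by c. With rho the identity and c = 1 this is invariance under isomorphism; with rho
    induced by eps |-> c eps it is compatibility with scalars. *)
Lemma kodaira_spencer_transport (a : cechH (endSheaf E) 1) : kodaira_spencer D a ->
  kodaira_spencer D' (cst (oT : opens X) (c : K^o) *: a).
Proof.
move=> /(kodaira_spencerE lfE)[z <- [sigma [sP zP]]].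
apply/(kodaira_spencerE lfE); exists (coc_scale (cst (oT : opens X) (c : K^o)) z).
  exact/esym/clsZ.
exists (fun x => @comp_hom _ _ _ _ _ _ unitH rho_unit _ _ _ theta _ (sigma x)).
split=> [x V h s|x V h h0 h1 s].
  by rewrite /= thetaP sP.
rewrite /= (zP _ _ h h0) mhomD theta_emb; congr (_ + emb _ _ _ (_ *: _)).
by rewrite !cst_res; reflexivity.
Qed.
End Transport.

Section PairIso.
Variables (i : {linear H0 E -> H0 E}).
Lemma pair_iso_ks (D D' : pair_deformation i DN) a :
  pair_iso D D' -> kodaira_spencer D a -> kodaira_spencer D' a.
Proof.
move=> [phi [psi [_ phiP _ _]]] Da.
rewrite -[a]scale1r -[1](_ : cst (oT : opens X) (1 : K^o) = 1); last exact: regfun_eq.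
apply: (@kodaira_spencer_transport (idRSH _) _ _ _ D D' phi) => // V.
by apply: regfun_eq => x; rewrite regfunME /= /unit_map scale1r mul1r.
Qed.
End PairIso.

End KodairaSpencerClass.

(** * Functions with values in the dual numbers, f = f_0 + eps f_1 *)

Section EpsCoefficient.
Context {K : fieldType} {n : nat} (X : set (projSpace K n)).
Notation DN := (@dual_numbers K).
Notation unitH := (unitHom X DN).
Notation augH := (strHom X (art_aug DN)).

Lemma eps_coef_regular (V : opens X) (f : regfun DN V) :
  is_regular (fun x => (f x).2 : K^o).
Proof.
move=> x; have [W Wx [s sW fs]] := regfunP f x; exists W => //.
exists [seq (t.1, t.2.2) | t <- s]; first by move=> t /mapP[t' /sW ? ->].
move=> y Wy; rewrite big_map /= fs //.
by elim: {sW fs} s => [|t s IH]; rewrite ?big_nil ?big_cons // -IH.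
Qed.
Definition eps_coef (V : opens X) (f : strSheaf X DN V) : OX X V :=
  mkRegFun (@eps_coef_regular V f).

Lemma eps_coefE (V : opens X) (f : strSheaf X DN V) x :
  (eps_coef f : regfun _ V) x = ((f : regfun DN V) x).2.
Proof. by []. Qed.

Lemma eps_coef_res (U V : opens X) (h : V `<=` U) f :
  eps_coef (rres h f) = rres h (eps_coef f).
Proof. exact: regfun_eq. Qed.

Lemma eps_coefD (V : opens X) : {morph @eps_coef V : f g / f + g}.
Proof. by move=> f g; apply: regfun_eq. Qed.

Lemma dual_mul2 (a b : DN) : (a * b).2 = (a.1 : K) * b.2 + (b.1 : K) * a.2.
Proof. by []. Qed.

(** The Leibniz rule for f |-> f_1, a derivation along the augmentation f |-> f_0. *)
Lemma eps_coefM (V : opens X) (f g : strSheaf X DN V) :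
  eps_coef (f * g) = augH V f * eps_coef g + augH V g * eps_coef f.
Proof. by apply: regfun_eq => x; 
rewrite !eps_coefE regfunME dual_mul2.
Qed.

Lemma eps_coef1 (V : opens X) : eps_coef (1 : strSheaf X DN V) = 0.
Proof. exact: regfun_eq. Qed.

Lemma regfun_dualE (V : opens X) (f : strSheaf X DN V) :
  f = unitH V (augH V f) + epsc V * unitH V (eps_coef f).
Proof.
apply: regfun_eq => x.
rewrite -[RHS]/((unitH V (augH V f) : regfun DN V) x
  + (epsc V * unitH V (eps_coef f) : regfun DN V) x) regfunME epsM /= /unit_map.
case: (regfun_val f x) => a b.
rewrite -[RHS]/((a * 1 + 0, a *: 0 + b * 1) : K^o * K^o).
by rewrite scaler0 !mulr1 addr0 add0r.
Qed.
End EpsCoefficient.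

(** * Deformations with the same class are isomorphic *)

Section Isomorphism.
Context {K : fieldType} {n : nat} (X : set (projSpace K n)).
Notation DN := (@dual_numbers K).
Notation unitH := (unitHom X DN).
Notation augH := (strHom X (art_aug DN)).
Notation idH := (idRSH (strSheaf X DN)).
Variables (E : modSheaf (OX X)) (lfE : locally_free E) (D D' : deformation DN E).
Notation j := (emb D lfE).
Notation j' := (emb D' lfE).

Section FiveLemma.
Variable phi : modSheafHom idH D D'.
Hypothesis phiP : forall (V : opens X) (s : D V), dfp D' V (phi V s) = dfp D V s.

Lemma iso_emb (V : opens X) (b : E V) : phi V (j V b) = j' V b.
Proof.
apply: mres_sep => x Vx; have [W [h [Wx [t tb]]]] := dfp_local_surj D b Vx.
by exists W, h; split=> //; rewrite -!mhom_res -tb emb_dfp mhomZ -phiP emb_dfp.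
Qed.

Lemma iso_inj (V : opens X) : injective (phi V).
Proof.
move=> s t e; apply/eqP; rewrite -subr_eq0; apply/eqP.
have st0 : phi V (s - t) = 0 by rewrite mhomB e subrr.
have [|b bP] := @dfp_ker_emb _ _ _ _ D lfE V (s - t).
  by rewrite -phiP st0 mhom00.
by rewrite bP; rewrite bP iso_emb in st0; rewrite (emb_inj0 st0) mhom00.
Qed.

(** The five lemma, with the identity of E on the kernel and on the quotient. Preimages are found
    locally and glue by injectivity. *)
Lemma iso_bij (V : opens X) : bijective (phi V).
Proof.
have surj (t : D' V) : exists s, phi V s = t.
  have [|W hW s s'|x Vx|s sP] :=
      @mres_glue _ _ D V (fun W h s => phi W s = mres h t).
  - by move=> W W' hW hW' k s e; rewrite mhom_res e (mres_comp _ _ hW').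
  - by move=> <- /esym; exact: iso_inj.
  - have [W [h [Wx [s e]]]] := dfp_local_surj D (dfp D' V t) Vx.
    exists W, h; split=> //.
    have [|b bP] := @dfp_ker_emb _ _ _ _ D' lfE W (mres h t - phi W s).
      by rewrite mhomB phiP e mhom_res subrr.
    by exists (s + j W b); rewrite mhomD iso_emb -bP addrC subrK.
  exists s; apply: mres_sep => x Vx; have [W [h [Wx e]]] := sP x Vx.
  by exists W, h; split=> //; rewrite -e mhom_res.
have [g gP] := choice_dep surj.
by exists g => s //; apply: iso_inj.
Qed.
End FiveLemma.

Section Local.
Variables (U : opens X) (sigma : hom_on unitH E D U) (tau : hom_on unitH E D' U).
Hypotheses (sP : splits sigma) (tP : splits tau).

(** Over U every d is uniquely sigma(s) + emb(b), with s its reduction; send it to tau(s) + emb'(b).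
    The point to check is linearity over K[eps] and not merely over O_X. *)
Lemma local_iso : exists f : homSheaf idH D D' U,
  (forall (V : opens X) (h : V `<=` U) (s : E V), homfun f h (sigma V h s) = tau V h s) /\
  (forall (V : opens X) (h : V `<=` U) (b : E V), homfun f h (j V b) = j' V b).
Proof.
have ex (V : opens X) (h : V `<=` U) (d : D V) : exists b, d - sigma V h (dfp D V d) = j V b.
  by apply: dfp_ker_emb; rewrite mhomB sP subrr.
have /choice_dep[g gP] (V : opens X) := choice_dep (fun h => choice_dep (ex V h)).
have gU V h d b : d = sigma V h (dfp D V d) + j V b -> g V h d = b.
  by move=> e; apply: (@emb_inj _ _ _ _ D lfE); rewrite -gP {1}e addrC addKr.
have dE V h d : d = sigma V h (dfp D V d) + j V (g V h d) by rewrite -gP addrC subrK.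
have gD V h d d' : g V h (d + d') = g V h d + g V h d'.
  by apply: gU; rewrite !mhomD homfunD {1}(dE V h d) {1}(dE V h d') addrACA.
(* In the coordinates (s, b), multiplication by f_0 + eps f_1 gives (f_0 s, f_0 b + f_1 s). *)
have gZ V h (a : strSheaf X DN V) d :
    g V h (a *: d) = augH V a *: g V h d + eps_coef a *: dfp D V d.
  apply: gU; rewrite mhomZ homfunZ mhomD !mhomZ emb_dfp addrA -scalerDr -dE.
  by rewrite {1}(regfun_dualE a) scalerDl scalerA (mulrC (epsc V)).
have gr (V W : opens X) hV hW (h : W `<=` V) d : g W hW (mres h d) = mres h (g V hV d).
  apply: gU; rewrite mhom_res (homfun_res _ hV) mhom_res -mresD; congr (mres _ _).
  exact: dE.
have fP : is_hom idH (fun V h d => tau V h (dfp D V d) + j' V (g V h d)).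
  split=> [V h d d'|V h a d|V W hV hW h d].
  - by rewrite gD !mhomD homfunD addrACA.
  - rewrite gZ mhomZ homfunZ mhomD !mhomZ addrA -scalerDr.
    rewrite [in RHS](regfun_dualE a) -[idH V _]/(_ + _) scalerDl; congr (_ + _).
    rewrite (mulrC (epsc V)) -scalerA scalerDr eps_emb addr0.
    by rewrite -emb_dfp tP.
  - by rewrite (gr V W hV) !mhom_res (homfun_res _ hV) mresD.
exists (HomOn fP); split=> V h s /=.
  rewrite sP (gU _ _ _ 0) ?mhom00 ?addr0 //.
  by rewrite sP.
rewrite dfp_emb homfun0 add0r (gU _ _ _ s) //.
by rewrite dfp_emb homfun0 add0r.
Qed.
End Local.

(** The property [P] asks that every sigma_y go to tau_y at once, which makes the solution unique.
    The local isomorphism built from a single x has it, because both families have the same cocycle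
    z. *)
Lemma iso_of_ks_family (U : @pcover X) (z : cochain (endSheaf E) U 1) sigma tau :
  @ks_family _ _ _ _ lfE D _ z sigma -> @ks_family _ _ _ _ lfE D' _ z tau ->
  exists phi : modSheafHom idH D D',
    forall (V : opens X) (s : D V), dfp D' V (phi V s) = dfp D V s.
Proof.
move=> [sP zs] [tP zt].
pose P (V : opens X) (_ : V `<=` oT) (f : homSheaf idH D D' V) : Prop :=
  (forall (x : X) (W : opens X) (k : W `<=` V) (h : W `<=` U x) (s : E W),
     homfun f k (sigma x W h s) = tau x W h s) /\
  (forall (W : opens X) (k : W `<=` V) (b : E W), homfun f k (j W b) = j' W b).
have decomp x (W : opens X) (h : W `<=` U x) (d : D W) :
    exists b, d = sigma x W h (dfp D W d) + j W b.
  have [|b bP] := @dfp_ker_emb _ _ _ _ D lfE W (d - sigma x W h (dfp D W d)).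
    by rewrite mhomB sP subrr.
  by exists b; rewrite -bP addrC subrK.
have [|V hV f g [f1 f2] [g1 g2]|x _|f fP] := @mres_glue _ _ (homSheaf idH D D') oT P.
- move=> V W hV hW k f [f1 f2].
  by split=> [x W' k' h s|W' k' b]; [exact: f1 | exact: f2].
- apply: hom_onP => W k d; apply: mres_sep => x Wx.
  exists (oI W (U x)), (oIl _ _); split; first by split=> //; exact: covP.
  have kW := subset_trans (oIl W (U x)) k.
  rewrite -!(homfun_res _ _ kW); have [b ->] := decomp x _ (oIr _ _) (mres (oIl _ _) d).
  by rewrite !homfunD f1 f2 g1 g2.
- exists (U x), (sub_oT _); split; first exact: covP.
  have [f [f1 f2]] := local_iso (sP x) (tP x).
  exists f; split=> [y W k h s|]; last exact: f2.
  pose xy (i : 'I_2) := if i == ord0 then x else y.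
  have hxy : W `<=` ccap U xy by move=> p Wp i; rewrite /xy; case: ifP => _; [exact: k | exact: h].
  rewrite (zs xy _ hxy k h) (zt xy _ hxy k h) homfunD f2; congr (_ + _).
  exact: f1.
exists (hom_oT f) => V d; apply: mres_sep => x Vx.
have [W [hW [Wx [f1 f2]]]] := fP x I.
pose W' := oI V (oI W (U x)).
have h : W' `<=` V := oIl _ _.
have hW' : W' `<=` W by move=> p [_ []].
have hU' : W' `<=` U x by move=> p [_ []].
exists W', h; split; first by split=> //; split=> //; exact: covP.
rewrite -!mhom_res; have [b ->] := decomp x _ hU' (mres h d).
rewrite !mhomD sP dfp_emb /=.
have := f1 x W' hW' hU' (dfp D W' (mres h d)).
rewrite /= (homfun_irr _ _ (sub_oT W')) => ->.
have := f2 W' hW' b; rewrite /= (homfun_irr _ _ (sub_oT W')) => ->.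
by rewrite tP dfp_emb.
Qed.

Lemma iso_of_kodaira_spencer (a : cechH (endSheaf E) 1) :
  kodaira_spencer D a -> kodaira_spencer D' a ->
  exists phi : modSheafHom idH D D',
    forall (V : opens X) (s : D V), dfp D' V (phi V s) = dfp D V s.
Proof.
move=> /(kodaira_spencerE lfE)[z <- [sigma zs]] /(kodaira_spencerE lfE)[w].
move=> /esym/clsE[W [hz [hw [b bE]]]] [tau wt].
apply: (iso_of_ks_family (ks_family_res hz zs) (tau := _)).
(* Changing the second family of splittings by b makes the two cocycles equal on the nose. *)
rewrite (_ : cres hz (coc z) = cres hw (coc w) + delta b); last by rewrite -bE addrC subrK.
exact: ks_family_add (ks_family_res hw wt).
Qed.
End Isomorphism.

(** * Deformations of the pair *)

Section RestrictScalars.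
Context {K : fieldType} {A : comAlgType K} (W : lmodType A).

(** An A-module seen as a K-vector space: [tensor] carries only its A-module structure, while its
    universal property concerns bilinear maps into K-vector spaces. *)
Definition restr : Type := W.
HB.instance Definition _ := GRing.Zmodule.on restr.
Definition restr_scale (k : K) (w : restr) : restr := (k%:A : A) *: (w : W).
Fact restr_scaleA a b w : restr_scale a (restr_scale b w) = restr_scale (a * b) w.
Proof. by rewrite /restr_scale scalerA -scalerAl mul1r scalerA. Qed.
Fact restr_scale1 : left_id 1 restr_scale.
Proof. by move=> w; rewrite /restr_scale !scale1r. Qed.
Fact restr_scaleDr : right_distributive restr_scale +%R.
Proof. by move=> a w v; exact: scalerDr. Qed.
Fact restr_scaleDl w : {morph restr_scale^~ w : a b / a + b}.
Proof. by move=> a b; rewrite /restr_scale !scalerDl. Qed.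
HB.instance Definition _ := GRing.Zmodule_isLmodule.Build K restr
  restr_scaleA restr_scale1 restr_scaleDr restr_scaleDl.
End RestrictScalars.

Section TensorLift.
Context {K : fieldType} {A : comAlgType K} {U : lmodType K}.

Lemma tcls_sum (s : seq (U * A)) : tcls s = \sum_(t <- s) tpure t.1 t.2.
Proof.
elim: s => [|t s IH]; first by rewrite big_nil.
rewrite big_cons -IH -[RHS]/(tadd _ _) taddE /=; by case: t.
Qed.

Lemma tpureZ (a : A) u : a *: tpure u (1 : A) = tpure u a :> tensor U A.
Proof. by rewrite -[LHS]/(tscale _ _) tscaleE /tscal /= mulr1. Qed.

Lemma tpure1_linear : linear (fun u : U => tpure u (1 : A) : restr (tensor U A)).
Proof.
move=> k u v.
rewrite -[RHS]/(tadd (tscale (k%:A) (tpure u (1 : A))) (tpure v (1 : A))).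
rewrite tscaleE taddE; apply/tclsE => W b [bl br].
rewrite /tsum /tscal /= !big_cons big_nil !addr0 /= br mulr1.
have b0 : b u 0 = 0.
  have := bl u 1 0 0; rewrite !scale1r !addr0 => e.
  by apply: (addrI (b u 0)); rewrite -e addr0.
by rewrite -[k%:A]addr0 bl b0 addr0.
Qed.

Section Lift.
Variables (W : lmodType A) (f : {linear U -> restr W}).

Fact tlift_bilinear : bilinear_map (fun u (a : A) => a *: (f u : W) : restr W).
Proof.
split=> [u k a b|a k u v].
  by rewrite scalerDl -[RHS]/((k%:A : A) *: (a *: (f u : W) : W) + b *: (f u : W)) scalerA mulr_algl.
rewrite linearP -[LHS]/(a *: ((k%:A : A) *: (f u : W) + (f v : W))) scalerDr !scalerA.
by rewrite -[RHS]/((k%:A : A) *: (a *: (f u : W)) + a *: (f v : W)) scalerA mulrC.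
Qed.

(** Extension of scalars of a K-linear map. It is computed on a chosen representative, and
    [tlift_tcls] shows that any other gives the same value. *)
Definition tlift (x : tensor U A) : W :=
  tsum (fun u (a : A) => a *: (f u : W) : restr W) (repr x).

Lemma tlift_tcls s : tlift (tcls s) = \sum_(t <- s) t.2 *: (f t.1 : W).
Proof. exact: (trepr _ tlift_bilinear). Qed.

Lemma tlift_tpure u a : tlift (tpure u a) = a *: (f u : W).
Proof. by rewrite tlift_tcls big_seq1. Qed.

Fact tlift_linear : linear tlift.
Proof.
move=> a x y; have [s ->] := tclsP x; have [s' ->] := tclsP y.
rewrite -[a *: _ + _]/(tadd (tscale a _) _) tscaleE taddE !tlift_tcls big_cat big_map.
by rewrite scaler_sumr; congr (_ + _); apply: eq_bigr => t _; rewrite scalerA.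
Qed.
HB.instance Definition _ := GRing.isLinear.Build _ _ _ _ tlift tlift_linear.
End Lift.

Lemma tensor_ext (W : lmodType A) (f g : tensor U A -> W) : linear f -> linear g ->
  (forall u, f (tpure u 1) = g (tpure u 1)) -> f =1 g.
Proof.
move=> fl gl fg x; have [s ->] := tclsP x; rewrite tcls_sum.
pose f' : {linear tensor U A -> W} := HB.pack f (GRing.isLinear.Build _ _ _ _ f fl).
pose g' : {linear tensor U A -> W} := HB.pack g (GRing.isLinear.Build _ _ _ _ g gl).
rewrite -[f]/(f' : _ -> _) -[g]/(g' : _ -> _) !linear_sum; apply: eq_bigr => t _.
by rewrite -tpureZ !linearZ /= fg.
Qed.
End TensorLift.

Section Pairs.
Context {K : fieldType} {n : nat} (X : set (projSpace K n)).
Notation DN := (@dual_numbers K).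
Variables (E : modSheaf (OX X)) (lfE : locally_free E).
Notation idE := (idfun : {linear H0 E -> H0 E}).

Lemma gsecZ (A : comAlgType K) (M : modSheaf (strSheaf X A)) (a : A) (s : gsec M) :
  a *: s = cst (oT : opens X) a *: (s : M oT).
Proof. by []. Qed.

Lemma H0Z (a : K) (s : H0 E) : a *: s = cst (oT : opens X) (a : K^o) *: (s : E oT).
Proof. by []. Qed.

Lemma unitHom_cst (A : comAlgType K) (V : opens X) (a : K) :
  unitHom X A V (cst V (a : K^o)) = cst V (a%:A : A).
Proof. exact: regfun_eq. Qed.

Lemma pdi1 (A : artAlg K) (D : pair_deformation idE A) (u : H0 E) :
  dfp D oT (pdi D (tpure u 1)) = u.
Proof. by rewrite pdiP rmorph1 scale1r. Qed.

Lemma pair_iso_refl (A : artAlg K) (D : pair_deformation idE A) : pair_iso D D.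
Proof.
exists (@ModSheafHom _ _ _ (idRSH _) D D (fun V s => s) (fun _ _ _ => erefl)
  (fun _ _ _ => erefl) (fun _ _ _ _ => erefl)), idfun.
by split=> [V|//||//]; exists id.
Qed.

Lemma pair_iso_of_kodaira_spencer (D D' : pair_deformation idE DN) a :
  kodaira_spencer D a -> kodaira_spencer D' a -> pair_iso D D'.
Proof.
move=> Da D'a; have [phi phiP] := iso_of_kodaira_spencer lfE Da D'a.
pose j' := emb D' lfE.
(* phi i_A and i'_A differ by u |-> eps v(u), and v(u) lies in U because U is all of
   H^0(E); so the automorphism u |-> u + eps v(u) of U (x) A absorbs the difference. *)
have /choice_dep[v vP] (u : H0 E) :
    exists v : H0 E, phi oT (pdi D (tpure u 1)) - pdi D' (tpure u 1) = j' oT v.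
  by apply: dfp_ker_emb; rewrite mhomB phiP !pdi1 subrr.
have t1l (k : K) (u w : H0 E) : tpure (k *: u + w) (1 : DN) = (k%:A : DN) *: tpure u 1 + tpure w 1.
  exact: tpure1_linear.
have vl : linear v.
  move=> k u w; apply: (@emb_inj _ _ _ _ D' lfE); rewrite -vP mhomD H0Z mhomZ unitHom_cst.
  rewrite -!vP !t1l !linearP !gsecZ mhomD mhomZ [in RHS]scalerDr [RHS]addrACA.
  reflexivity.
(* The map u |-> u + c eps v(u) is built for every c, so that c = 1 gives the automorphism and c =
   -1 its inverse, because eps^2 = 0. *)
have /choice_dep[psi psiE] (c : K) : exists g : {linear tensor (H0 E) DN -> tensor (H0 E) DN},
    forall u, g (tpure u 1) = tpure u 1 + ((0, c) : DN) *: tpure (v u) 1.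
  pose f u : tensor (H0 E) DN := tpure u 1 + ((0, c) : DN) *: (tpure (v u) 1 : tensor (H0 E) DN).
  have fl : linear (f : H0 E -> restr (tensor (H0 E) DN)).
    move=> k u w; rewrite /f vl !t1l -[RHS]/((k%:A : DN) *: f u + f w) /f.
    by rewrite !scalerDr !scalerA (mulrC ((0, c) : DN)) addrACA.
  pose fL : {linear H0 E -> restr (tensor (H0 E) DN)} :=
    HB.pack f (GRing.isLinear.Build _ _ _ _ _ fl).
  exists (tlift fL) => u; rewrite -[RHS]scale1r; exact: (tlift_tpure fL u 1).
have eps20 (c d : K) : ((0, c) : DN) * ((0, d) : DN) = 0.
  by rewrite -[LHS]/(sqz_mul _ _) /sqz_mul /= mul0r !scale0r addr0.
have psiK c d : c + d = 0 -> cancel (psi c) (psi d).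
  move=> cd; apply: (@tensor_ext _ _ _ _ (psi d \o psi c) id); [move=> b x y| |move=> u] => //=.
    by rewrite !linearP.
  rewrite psiE linearD linearZ /= !psiE scalerDr scalerA eps20 scale0r addr0.
  have e0 : ((0, d) : DN) + ((0, c) : DN) = 0.
    by rewrite -[LHS]/((0 + 0, d + c) : DN) addr0 addrC cd.
  by rewrite -addrA -scalerDl e0 scale0r addr0.
exists phi, (psi 1); split=> //.
- exact: iso_bij.
- by exists (psi (-1)); apply: psiK; rewrite ?subrr ?addNr.
apply: (@tensor_ext _ _ _ (gsec D') (fun t => phi oT (pdi D t)) (fun t => pdi D' (psi 1 t))) => [b x y|b x y|u].
- by rewrite linearP mhomD !gsecZ mhomZ.
- by rewrite !linearP.
rewrite psiE linearD linearZ /= gsecZ.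
rewrite -[cst oT _]/(epsc oT) -emb_dfp pdi1 -vP addrC subrK.
reflexivity.
Qed.

Lemma Def_class_inj (A : artAlg K) (D D' : pair_deformation idE A) :
  Def_class D = Def_class D' -> pair_iso D D'.
Proof. by move=> [->]; exact: pair_iso_refl. Qed.

(** A point of [Def] is the predicate [pair_iso D]. For any D of class a this predicate is having
    class a, so it does not depend on D; symmetry and transitivity of [pair_iso] are bypassed. *)
Lemma kodaira_spencer_Def_class (D D' : pair_deformation idE DN) a :
  kodaira_spencer D a -> kodaira_spencer D' a -> Def_class D = Def_class D'.
Proof.
move=> Da D'a.
have e (C : pair_deformation idE DN) : kodaira_spencer C a ->
    pair_iso C = fun C' => kodaira_spencer C' a :> Prop.
  move=> Ca; apply/funext => C'; apply/propext; split.
    by move/pair_iso_ks; exact.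
  exact: pair_iso_of_kodaira_spencer.
have eDD' : pair_iso D = pair_iso D' by rewrite !e.
by apply: eq_exist.
Qed.

End Pairs.

(** * Lifting global sections and the cup product *)

Section Cup.
Context {K : fieldType} {n : nat} (X : set (projSpace K n)).
Notation DN := (@dual_numbers K).
Notation unitH := (unitHom X DN).
Variables (E : modSheaf (OX X)) (lfE : locally_free E) (D : deformation DN E).
Notation j := (emb D lfE).

Section Family.
Variables (U : @pcover X) (z : cochain (endSheaf E) U 1).
Variables (sigma : forall x : X, hom_on unitH E D (U x)) (zP : ks_family lfE z sigma).
Variable s : E oT.

(* The lift is glued from the sections sigma_x s - eps sigma_x b_x. *)
Lemma lift_of_coboundary (b : cochain E U 0) : cochain_map (ev s) z = delta b ->
  exists S : D oT, dfp D oT S = s.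
Proof.
move=> zb; have [sP zs] := zP.
pose bx x : E (U x) := mres (@ccap_pt _ U x) (b (fun=> x)).
pose P (V : opens X) (_ : V `<=` oT) (S : D V) : Prop :=
  forall x (W : opens X) (k : W `<=` V) (h : W `<=` U x),
    mres k S = sigma x W h (mres (sub_oT W) s) - j W (mres h (bx x)).
have [|V hV S S' SP SP'|x _|S SP] := @mres_glue _ _ D oT P.
- move=> V W hV hW k S SP x W' k' h; rewrite (mres_comp _ _ (subset_trans k' k)); exact: SP.
- apply: mres_sep => x Vx; exists (oI V (U x)), (oIl _ _); split; first by split=> //; exact: covP.
  by rewrite (SP x _ _ (oIr _ _)) (SP' x _ _ (oIr _ _)).
- exists (U x), (sub_oT _); split; first exact: covP.
  exists (sigma x (U x) (@subset_refl _ _) (mres (sub_oT _) s) - j (U x) (bx x)).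
  move=> y W k h.
  rewrite mresB -mhom_res -(homfun_res _ _ k) (mres_comp _ _ (sub_oT W)).
  pose xy (i : 'I_2) := if i == ord0 then x else y.
  have hxy : W `<=` ccap U xy by move=> p Wp i; rewrite /xy; case: ifP => _; [exact: k | exact: h].
  rewrite (zs xy _ hxy k h) -addrA -mhomB; congr (_ + _).
  (* On the overlap the two candidates differ by [emb] of z s - (b_y - b_x), which vanishes since z
     s = delta b. *)
  have : mres hxy (cochain_map (ev s) z xy) = homfun (z xy) hxy (mres (sub_oT W) s).
    rewrite -mhom_res /= /ev_fun /=; congr (homfun (z xy) _ _); last exact: mres_irr.
    exact: Prop_irrelevance.
  rewrite zb delta0E mresB => <-.
  rewrite (mres_comp _ _ (subset_trans h (@ccap_pt _ U y))).
  rewrite (mres_comp _ _ (subset_trans k (@ccap_pt _ U x))).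
  rewrite /bx !(mres_comp _ _ (subset_trans h (@ccap_pt _ U y))).
  rewrite (mres_comp _ _ (subset_trans k (@ccap_pt _ U x))).
  by rewrite addrAC subrr mhomB mhom00 sub0r.
exists S; apply: mres_sep => x _; have [V [h [Vx SV]]] := SP x I.
exists (oI V (U x)), (sub_oT _); split; first by split=> //; exact: covP.
rewrite -mhom_res -(mres_comp h (oIl V (U x))) (SV x _ _ (oIr V (U x))).
by rewrite mhomB sP dfp_emb subr0.
Qed.

Lemma coboundary_of_lift (S : D oT) : dfp D oT S = s ->
  exists b : cochain E U 0, cochain_map (ev s) z = delta b.
Proof.
move=> Ss; have [sP zs] := zP.
have /choice_dep[t tP] (x : X) : exists t : E (U x),
    mres (sub_oT (U x)) S - sigma x (U x) (@subset_refl _ _) (mres (sub_oT _) s) = j (U x) t.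
  by apply: dfp_ker_emb; rewrite mhomB sP mhom_res Ss subrr.
(* The sign: emb (z s) = sigma_y s - sigma_x s = emb (t_x - t_y), whereas [delta] is the value at y
   minus the value at x. *)
exists (fun y => - mres (@ccap_le _ U _ y ord0) (t (y ord0))).
apply: cochainP => x; rewrite delta0E !(@mresN _ _ E) opprK.
pose h0 := @ccap_le _ U _ x ord0; pose h1 := @ccap_le _ U _ x ord_max.
rewrite (mres_comp _ _ h1) (mres_comp _ _ h0).
rewrite addrC; apply: (@emb_inj _ _ _ _ D lfE); rewrite mhomB !mhom_res -!tP !mresB.
rewrite -!(homfun_res _ _ h0) -!(homfun_res _ _ h1) !(mres_comp _ _ (sub_oT (ccap U x))).
rewrite (zs x _ (@subset_refl _ _) h0 h1) opprB !addrA subrK addrAC subrr add0r.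
congr (j _ _); rewrite /cochain_map /= /ev_fun.
by congr (homfun (z x) _ _); exact: mres_irr.
Qed.
End Family.

(** With sigma_x s as local lifts of s, the cochain z s represents the image of s under the
    connecting map of 0 -> E -> E_A -> E -> 0; so a cup s is the obstruction to lifting s. *)
Lemma cup0P (a : cechH (endSheaf E) 1) (s : E oT) : kodaira_spencer D a ->
  cup a s = 0 <-> exists S : D oT, dfp D oT S = s.
Proof.
move=> /(kodaira_spencerE lfE)[z <- [sigma zP]].
rewrite /cup cechH_mapE -[0]/(cls (coc_zero E 1)); split=> [/clsE|[S SS]].
  move=> [W [h [h' [b bP]]]].
  apply: (lift_of_coboundary (ks_family_res h zP) (b := b)).
  rewrite -bP /= linear0 subr0; apply: cochainP => x.
  by rewrite /cochain_map /cres -ev_res.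
have [b bP] := coboundary_of_lift zP SS; apply/clsE.
exists (coc_cover z), (@finer_refl _ _), (fun _ _ _ => I), b; rewrite -bP /= linear0 subr0.
by apply: cochainP => x; rewrite /cres mres_id.
Qed.
End Cup.

(* By Zorn on graphs of partial sections: H^0(E) is not shown to be finite dimensional. *)
Lemma linear_section (K : fieldType) (V W : lmodType K) (f : {linear V -> W}) :
  (forall w, exists v, f v = w) -> exists g : {linear W -> V}, cancel g f.
Proof.
move=> surj.
pose P (G : set (W * V)%type) := [/\ forall k a b, G a -> G b -> G (k *: a + b),
  forall a, G a -> f a.2 = a.1 & forall v, G (0, v) -> v = 0].
have [F FP Ftot|G [[Glin Gf G0] Gmax]] := @Zorn_bigcup _ P.
  split=> [k a b [G FG Ga] [H FH Hb]|a [G FG Ga]|v [G FG Gv]].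
  - have [GH|HG] := Ftot _ _ FG FH.
      by exists H => //; have [+ _ _] := FP _ FH; apply=> //; exact: GH.
    by exists G => //; have [+ _ _] := FP _ FG; apply=> //; exact: HG.
  - by have [_ + _] := FP _ FG; exact.
  - by have [_ _] := FP _ FG; exact.
(* The properties in [P] allow the empty graph, which Zorn's lemma needs for the empty chain;
   maximality against {0} excludes it. *)
have G00 : G 0.
  apply: contrapT => nG0.
  have Ge a : ~ G a by move=> Ga; apply: nG0; rewrite -(addNr a) -scaleN1r; exact: Glin.
  apply: (Gmax [set 0]).
    by split=> [a /Ge|/(_ 0 erefl)].
  split=> [k a b -> ->|a ->|v [->]] //; first by rewrite scaler0 addr0.
  by rewrite linear0.
have Gdom w : exists v, G (w, v).
  apply: contrapT => nw; have [v vw] := surj w.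
  pose H : set (W * V)%type := [set a | exists k b, G b /\ a = k *: (w, v) + b].
  apply: (Gmax H).
    split=> [a Ga|HG]; first by exists 0, a; rewrite scale0r add0r.
    by apply: nw; exists v; apply: HG; exists 1, 0; rewrite scale1r addr0.
  split=> [k a b [k1 [a' [Ga ->]]] [k2 [b' [Gb ->]]]|a [k [b [Gb ->]]]|u [k [b [Gb]]]].
  - exists (k * k1 + k2), (k *: a' + b'); split; first exact: Glin.
    by rewrite scalerDr scalerDl scalerA addrACA.
  - by rewrite /= linearP vw (Gf b Gb).
  - case: b Gb => b1 b2 Gb [e1 ->].
    (* The enlarged graph stays single-valued: if k were nonzero, w would already lie in the domain
       of G. *)
    have [k0|k0] := eqVneq k 0.
      by move: e1 Gb; rewrite k0 !scale0r !add0r => <- /G0.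
    case: nw; exists (- k^-1 *: b2).
    rewrite (_ : (w, _) = - k^-1 *: (b1, b2) + 0); first exact: Glin.
    have -> : b1 = - (k *: w) by apply/eqP; rewrite -addr_eq0 addrC -e1.
    congr (_, _); rewrite /= ?addr0 //.
    by rewrite scaleNr scalerN opprK scalerA mulVf // scale1r.
have [g gP] := choice Gdom.
have gU w v : G (w, v) -> g w = v.
  move=> Gv; apply/eqP; rewrite -subr_eq0; apply/eqP/G0.
  rewrite (_ : (0, _) = -1 *: (w, v) + (w, g w)); first exact: Glin.
  by congr (_, _); rewrite /= scaleN1r ?addNr // addrC.
have gl : linear g by move=> k u w; apply: gU; exact: (Glin k (u, g u) (w, g w)).
pose g' : {linear W -> V} := HB.pack g (GRing.isLinear.Build _ _ _ _ g gl).
by exists g' => w; exact: (Gf _ (gP w)).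
Qed.

Section PairOfDeformation.
Context {K : fieldType} {n : nat} (X : set (projSpace K n)).
Variables (A : artAlg K) (E : modSheaf (OX X)) (D : deformation A E).
Notation idE := (idfun : {linear H0 E -> H0 E}).

Definition dfp0 (S : restr (gsec D)) : H0 E := dfp D oT S.
Fact dfp0_linear : linear dfp0.
Proof.
move=> k s t; rewrite /dfp0 -[k *: s + t]/((cst (oT : opens X) (k%:A : A) *: (s : D oT)) + (t : D oT)).
rewrite mhomD mhomZ strHom_cst linearZ /= rmorph1 H0Z; congr (cst _ _ *: _ + _).
exact: mulr1.
Qed.
HB.instance Definition _ := GRing.isLinear.Build _ _ _ _ dfp0 dfp0_linear.

Lemma pair_of_deformation : (forall s : H0 E, exists S : D oT, dfp D oT S = s) ->
  exists P : pair_deformation idE A, P = D :> deformation A E.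
Proof.
move=> /(@linear_section _ _ _ dfp0)[g gK].
unshelve eexists (@PairDeformation _ _ _ E (H0 E) idE A D (tlift g) _) => // u a.
transitivity (dfp D oT (a *: (g u : gsec D))).
  by congr (dfp D oT _); exact: (@tlift_tpure _ _ _ (gsec D) g u a).
rewrite gsecZ mhomZ strHom_cst.
rewrite [dfp D oT _]gK H0Z; reflexivity.
Qed.
End PairOfDeformation.

(** * The deformation attached to a cocycle *)

Section Twist.
Context {K : fieldType} {n : nat} (X : set (projSpace K n)).
Notation DN := (@dual_numbers K).
Notation augH := (strHom X (art_aug DN)).
Variables (E : modSheaf (OX X)) (U : @pcover X) (z : cochain (endSheaf E) U 1).

Lemma mres_mres (V1 V2 V3 : opens X) (h1 : V2 `<=` V1) (h2 : V3 `<=` V2) (s : E V1) :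
  mres h2 (mres h1 s) = mres (subset_trans h2 h1) s.
Proof. exact: mres_comp. Qed.

Definition pt2 (x y : X) (i : 'I_2) : X := if i == ord0 then x else y.

Lemma pt2_sub (V : opens X) (x y : X) : V `<=` U x -> V `<=` U y -> V `<=` ccap U (pt2 x y).
Proof. by move=> hx hy p Vp i; rewrite /pt2; case: ifP => _; [exact: hx | exact: hy]. Qed.

Definition tr (x y : X) (V : opens X) (hx : V `<=` U x) (hy : V `<=` U y) (s : E V) : E V :=
  homfun (z (pt2 x y)) (pt2_sub hx hy) s.

Arguments tr x y [V] hx hy s.

Lemma trD x y (V : opens X) hx hy : {morph @tr x y V hx hy : s t / s + t}.
Proof. exact: homfunD. Qed.
Lemma tr0 x y (V : opens X) hx hy : @tr x y V hx hy 0 = 0.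
Proof. exact: homfun0. Qed.
Lemma trZ x y (V : opens X) hx hy (a : OX X V) s :
  @tr x y V hx hy (a *: s) = a *: tr x y hx hy s.
Proof. exact: homfunZ. Qed.
Lemma tr_res x y (V W : opens X) hx hy (h : W `<=` V) hx' hy' s :
  @tr x y W hx' hy' (mres h s) = mres h (@tr x y V hx hy s).
Proof. exact: homfun_res. Qed.

Lemma trE (x : 'I_2 -> X) (V : opens X) (h : V `<=` ccap U x)
    (h0 : V `<=` U (x ord0)) (h1 : V `<=` U (x ord_max)) (s : E V) :
  homfun (z x) h s = tr (x ord0) (x ord_max) h0 h1 s.
Proof.
have e : x =1 pt2 (x ord0) (x ord_max).
  by move=> i; rewrite /pt2; case: eqP => [->//|/eqP i0]; congr x; apply: val_inj; case: i i0 => -[|[]].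
have := @cochain_mres _ _ _ _ _ z _ _ V h (pt2_sub h0 h1) e.
move/(congr1 (fun f : endSheaf E V => homfun f (@subset_refl _ V) s)) => /=.
by rewrite homfun_irr => ->; exact: homfun_irr.
Qed.

Hypothesis dz : delta z = 0.

Lemma tr_trans (x y w : X) (V : opens X) hx hy hw (s : E V) :
  @tr x w V hx hw s = tr x y hx hy s + tr y w hy hw s.
Proof.
pose t (i : 'I_3) : X := if i == ord0 then x else if i == ord_max then w else y.
have h : V `<=` ccap U t.
  by move=> p Vp i; rewrite /t; case: ifP => _; [exact: hx|case: ifP => _; [exact: hw|exact: hy]].
have := congr1 (fun f : cochain (endSheaf E) U 2 => homfun (f t) h s) dz.
rewrite /= delta1E /=.
rewrite (trE (x:=fun j => t (lift ord0 j)) _ hy hw).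
rewrite (trE (x:=fun j => t (lift (lift ord0 ord0) j)) _ hx hw).
rewrite (trE (x:=fun j => t (lift ord_max j)) _ hx hy).
rewrite addrAC => /eqP; rewrite addr_eq0 opprK => /eqP <-; exact: addrC.
Qed.

Lemma subI (V W W' : opens X) : W `<=` V -> W `<=` W' -> W `<=` oI V W'.
Proof. by move=> h k p Wp; split; [exact: h | exact: k]. Qed.

(* A pair (s, t) stands for the section glued from sigma_x s + eps sigma_x t_x, where
   sigma_y = sigma_x + eps sigma_x z_(x, y). *)
Record tw (V : opens X) := Tw {
  tws : E V;
  twt : forall x : X, E (oI V (U x));
  twP : forall (x y : X) (W : opens X) (hV : W `<=` V) (hx : W `<=` U x) (hy : W `<=` U y),
    mres (subI hV hx) (twt x) = tr x y hx hy (mres hV tws) + mres (subI hV hy) (twt y) }.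

Lemma tw_eq (V : opens X) (a b : tw V) :
  tws a = tws b -> (forall x, twt a x = twt b x) -> a = b.
Proof.
case: a b => [s t p] [s' t' p'] /= e e'.
have {}e' : t = t' := functional_extensionality_dep e'.
by subst; congr Tw; exact: Prop_irrelevance.
Qed.

Section Module.
Variable V : opens X.
Implicit Types a b : tw V.

HB.instance Definition _ := gen_eqMixin (tw V).
HB.instance Definition _ := gen_choiceMixin (tw V).

Fact tw_zero_subproof (x y : X) (W : opens X) (hV : W `<=` V) (hx : W `<=` U x) (hy : W `<=` U y) :
  mres (subI hV hx) (0 : E _) = tr x y hx hy (mres hV (0 : E _)) + mres (subI hV hy) (0 : E _).
Proof. by rewrite !(@mres0 _ _ E) tr0 addr0. Qed.
Definition tw_zero : tw V := Tw tw_zero_subproof.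

Fact tw_add_subproof a b (x y : X) (W : opens X) (hV : W `<=` V) (hx : W `<=` U x) (hy : W `<=` U y) :
  mres (subI hV hx) (twt a x + twt b x)
  = tr x y hx hy (mres hV (tws a + tws b)) + mres (subI hV hy) (twt a y + twt b y).
Proof. by rewrite !mresD trD !(twP _ hV hx hy) addrACA. Qed.
Definition tw_add a b : tw V := Tw (tw_add_subproof a b).

(** The action is read off from (f_0 + eps f_1)(s + eps t_x) = f_0 s + eps (f_0 t_x + f_1 s). *)
Fact tw_scale_subproof (f : strSheaf X DN V) a (x y : X) (W : opens X)
    (hV : W `<=` V) (hx : W `<=` U x) (hy : W `<=` U y) :
  mres (subI hV hx) (rres (oIl V (U x)) (augH V f) *: twt a x
     + rres (oIl V (U x)) (eps_coef f) *: mres (oIl V (U x)) (tws a))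
  = tr x y hx hy (mres hV (augH V f *: tws a)) +
    mres (subI hV hy) (rres (oIl V (U y)) (augH V f) *: twt a y
     + rres (oIl V (U y)) (eps_coef f) *: mres (oIl V (U y)) (tws a)).
Proof.
have [_ rc _] := rsheaf (OX X).
rewrite !mresD !mresZ !(rc _ _ _ _ _ hV) !(mres_comp _ _ hV) trZ (twP a hV hx hy).
by rewrite scalerDr addrA.
Qed.
Definition tw_scale (f : strSheaf X DN V) a : tw V := Tw (tw_scale_subproof f a).

Fact tw_opp_subproof a (x y : X) (W : opens X)
    (hV : W `<=` V) (hx : W `<=` U x) (hy : W `<=` U y) :
  mres (subI hV hx) (- twt a x) = tr x y hx hy (mres hV (- tws a)) + mres (subI hV hy) (- twt a y).
Proof.
rewrite !(@mresN _ _ E) (twP a hV hx hy) opprD; congr (_ + _).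
by rewrite -!scaleN1r trZ.
Qed.
Definition tw_opp a : tw V := Tw (tw_opp_subproof a).

Fact tw_addA : associative tw_add.
Proof. by move=> a b c; apply: tw_eq => [|x] /=; rewrite addrA. Qed.
Fact tw_addC : commutative tw_add.
Proof. by move=> a b; apply: tw_eq => [|x] /=; rewrite addrC. Qed.
Fact tw_add0 : left_id tw_zero tw_add.
Proof. by move=> a; apply: tw_eq => [|x] /=; rewrite add0r. Qed.
Fact tw_addN : left_inverse tw_zero tw_opp tw_add.
Proof. by move=> a; apply: tw_eq => [|x] /=; rewrite addNr. Qed.
HB.instance Definition _ := GRing.isZmodule.Build (tw V) tw_addA tw_addC tw_add0 tw_addN.

Fact tw_scaleA f g a : tw_scale f (tw_scale g a) = tw_scale (f * g) a.
Proof.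
apply: tw_eq => [|x] /=; first by rewrite scalerA rmorphM.
by rewrite eps_coefM !rmorphM !rmorphD !rmorphM mresZ scalerDr scalerDl !scalerA addrA
  [rres _ (augH V g) * _]mulrC.
Qed.
Fact tw_scale1 : left_id 1 tw_scale.
Proof.
move=> a; apply: tw_eq => [|x] /=; first by rewrite rmorph1 scale1r.
by rewrite eps_coef1 rmorph0 !rmorph1 scale1r scale0r addr0.
Qed.
Fact tw_scaleDr : right_distributive tw_scale +%R.
Proof.
move=> f a b; apply: tw_eq => [|x] /=; first by rewrite scalerDr.
by rewrite mresD !scalerDr addrACA.
Qed.
Fact tw_scaleDl a : {morph tw_scale^~ a : f g / f + g}.
Proof.
move=> f g; apply: tw_eq => [|x] /=; first by rewrite rmorphD scalerDl.
by rewrite eps_coefD !rmorphD !scalerDl addrACA.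
Qed.
HB.instance Definition _ := GRing.Zmodule_isLmodule.Build (strSheaf X DN V) (tw V)
  tw_scaleA tw_scale1 tw_scaleDr tw_scaleDl.
End Module.
End Twist.

Arguments tr {K n X E U} z x y [V] hx hy s.

Section TwistSheaf.
Context {K : fieldType} {n : nat} (X : set (projSpace K n)).
Notation DN := (@dual_numbers K).
Notation unitH := (unitHom X DN).
Notation augH := (strHom X (art_aug DN)).
Variables (E : modSheaf (OX X)) (U : @pcover X) (z : cochain (endSheaf E) U 1).
Hypothesis dz : delta z = 0.
Notation tw := (tw z).
Notation tr := (tr z).

Lemma oI_mono (V W W' : opens X) : W `<=` V -> oI W W' `<=` oI V W'.
Proof. by move=> h p [/h]. Qed.

Section Restriction.
Variables (V W : opens X) (h : W `<=` V).
Fact tw_res_subproof (a : tw V) (x y : X) (W' : opens X)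
    (hV : W' `<=` W) (hx : W' `<=` U x) (hy : W' `<=` U y) :
  mres (subI hV hx) (mres (oI_mono h) (twt a x))
  = tr x y hx hy (mres hV (mres h (tws a))) + mres (subI hV hy) (mres (oI_mono h) (twt a y)).
Proof.
pose hV' := subset_trans hV h.
rewrite (mres_comp _ _ (subI hV' hx)) (mres_comp _ _ (subI hV' hy)) (mres_comp _ _ hV').
exact: twP.
Qed.
Definition tw_res (a : tw V) : tw W := Tw (tw_res_subproof a).

Fact tw_resD : {morph tw_res : a b / a + b}.
Proof. by move=> a b; apply: tw_eq => [|x] /=; rewrite mresD. Qed.

Fact tw_resZ (f : strSheaf X DN V) (a : tw V) :
  tw_res (f *: a) = (rres h f : strSheaf X DN W) *: tw_res a.
Proof.
have [_ rc _] := rsheaf (OX X).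
have hU x : oI W (U x) `<=` V by move=> p [/h].
have ar := @rhom_res _ _ _ augH V W h f; rewrite /= in ar.
apply: tw_eq => [|x] /=; first by rewrite mresZ ar.
rewrite mresD !mresZ ar eps_coef_res.
by rewrite !(rc _ _ _ _ _ (hU x)) !(mres_comp _ _ (hU x)).
Qed.
End Restriction.

(** Each component glues in E: s over V, and every t_x over the intersection of V with U_x. The
    relation between t_x and t_y is an equality of sections, hence local. *)
Fact tw_sheaf : is_sheaf tw_res.
Proof.
have [_ _ Eglue] := msheaf E.
split=> [V h a|V1 V2 V3 h1 h2 h3 a|I V Vi hV cov a acompat].
- by apply: tw_eq => [|x] /=; exact: mres_id.
- by apply: tw_eq => [|x] /=; exact: mres_comp.
have acs i j := congr1 (@tws _ _ _ _ _ _ _) (acompat i j).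
have act i j x := congr1 (fun b => twt b x) (acompat i j).
rewrite /= in acs act.
have [s [sP sU]] := Eglue _ V Vi hV cov _ acs.
pose hVx i x : oI (Vi i) (U x) `<=` oI V (U x) := oI_mono (hV i).
have /choice_dep[t tP] (x : X) : exists t : E (oI V (U x)),
    (forall i, mres (hVx i x) t = twt (a i) x) /\
    (forall t', (forall i, mres (hVx i x) t' = twt (a i) x) -> t = t').
  have [|i j|t [tP tU]] := Eglue _ (oI V (U x)) _ (hVx^~ x) _ (fun i => twt (a i) x).
  - by move=> p [Vp Up]; have [i _ Vip] := cov p Vp; exists i.
  - have k : oI (oI (Vi i) (U x)) (oI (Vi j) (U x)) `<=` oI (oI (Vi i) (Vi j)) (U x).
      by move=> p [[? ?] [? ?]].
    rewrite -(mres_comp (oI_mono (oIl (Vi i) (Vi j))) k) act.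
    exact: mres_comp.
  by exists t; split.
have twPst (x y : X) (W : opens X) (hW : W `<=` V) (hx : W `<=` U x) (hy : W `<=` U y) :
    mres (subI hW hx) (t x) = tr x y hx hy (mres hW s) + mres (subI hW hy) (t y).
  apply: mres_sep => p Wp; have [i _ Vip] := cov p (hW p Wp).
  have hxi := subset_trans (oIl W (Vi i)) hx; have hyi := subset_trans (oIl W (Vi i)) hy.
  exists (oI W (Vi i)), (oIl _ _); split=> //.
  rewrite mresD -(tr_res _ _ _ _ hxi hyi).
  have := twP (a i) (oIr W (Vi i)) hxi hyi.
  rewrite -sP -!(proj1 (tP _)) (mres_comp _ _ (subset_trans (oIl W (Vi i)) hW)) => e.
  rewrite (mres_comp _ _ (subset_trans (oIl W (Vi i)) hW)).
  have tx x' (hx' : W `<=` U x') (hxi' : oI W (Vi i) `<=` U x') :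
      mres (oIl W (Vi i)) (mres (subI hW hx') (t x'))
      = mres (subI (oIr W (Vi i)) hxi') (mres (hVx i x') (t x')).
    by rewrite !mres_mres; exact: mres_irr.
  by rewrite (tx x hx hxi) (tx y hy hyi).
exists (Tw twPst); split=> [i|b bP].
  by apply: tw_eq => [|x] /=; [exact: sP | exact: (proj1 (tP x))].
apply: tw_eq => [|x] /=; first by apply: sU => i; rewrite -bP.
by apply: (proj2 (tP x)) => i; rewrite -bP.
Qed.

Definition twMod : modSheaf (strSheaf X DN) := ModSheaf tw_resD tw_resZ tw_sheaf.

Definition tw_pi : modSheafHom (strHom X (art_aug DN)) twMod E :=
  @ModSheafHom _ _ _ (strHom X (art_aug DN)) twMod E (fun V (a : tw V) => tws a)
    (fun V a b => erefl) (fun V f a => erefl) (fun V W h a => erefl).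

Fact tw_emb_subproof (V : opens X) (b : E V) (x y : X) (W : opens X)
    (hV : W `<=` V) (hx : W `<=` U x) (hy : W `<=` U y) :
  mres (subI hV hx) (mres (oIl V (U x)) b)
  = tr x y hx hy (mres hV 0) + mres (subI hV hy) (mres (oIl V (U y)) b).
Proof. by rewrite (@mres0 _ _ E) tr0 add0r !(mres_comp _ _ hV). Qed.
Definition tw_emb (V : opens X) (b : E V) : twMod V := Tw (tw_emb_subproof b).

Section Splitting.
Variable x0 : X.

(** This is sigma_(x0) b written in the chart at x: sigma_(x0) = sigma_x + eps sigma_x z_(x, x0)
    gives t_x = z_(x, x0) b. Compatibility of the t_x is the cocycle condition. *)
Fact tw_spl_subproof (V : opens X) (h : V `<=` U x0) (b : E V) (x y : X) (W : opens X)
    (hV : W `<=` V) (hx : W `<=` U x) (hy : W `<=` U y) :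
  mres (subI hV hx) (tr x x0 (oIr V (U x)) (subset_trans (oIl V (U x)) h) (mres (oIl V (U x)) b))
  = tr x y hx hy (mres hV b) +
    mres (subI hV hy) (tr y x0 (oIr V (U y)) (subset_trans (oIl V (U y)) h) (mres (oIl V (U y)) b)).
Proof.
pose h0 := subset_trans hV h.
rewrite -(tr_res _ _ _ _ hx h0) -(tr_res _ _ _ _ hy h0) !(mres_comp _ _ hV).
exact: tr_trans.
Qed.
Definition tw_spl (V : opens X) (h : V `<=` U x0) (b : E V) : twMod V := Tw (tw_spl_subproof h b).

Fact tw_spl_hom : is_hom unitH tw_spl.
Proof.
split=> [V h b c|V h f b|V W hV hW h b].
- by apply: tw_eq => [|x] //=; rewrite mresD trD.
- have af := @aug_unitHom _ _ X DN V f; rewrite /= in af.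
  apply: tw_eq => [|x] /=; first by rewrite af.
  rewrite mresZ trZ af (_ : eps_coef _ = 0) ?rmorph0 ?scale0r ?addr0 //.
  by apply: regfun_eq => p; rewrite eps_coefE /= /unit_map /=; exact: mulr0.
- apply: tw_eq => [|x] //=.
  rewrite -(tr_res _ _ _ _ (oIr W (U x)) (subset_trans (oIl W (U x)) hW)); congr tr.
  by rewrite !mres_mres; exact: mres_irr.
Qed.
Definition tw_split : hom_on unitH E twMod (U x0) := HomOn tw_spl_hom.

Lemma tw_spl0 (V : opens X) (h : V `<=` U x0) : tw_spl h 0 = 0.
Proof. exact: (homfun0 tw_split h). Qed.

Lemma tw_splitZ (V : opens X) (h : V `<=` U x0) (f : strSheaf X DN V) (b : E V) :
  f *: tw_spl h b = tw_spl h (augH V f *: b) + tw_emb (eps_coef f *: b).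
Proof.
apply: tw_eq => [|x] /=; first by rewrite addr0.
by rewrite !mresZ trZ.
Qed.

Lemma tw_decomp (V : opens X) (h : V `<=` U x0) (a : twMod V) :
  a = tw_spl h (tws a) + tw_emb (mres (subI (@subset_refl _ V) h) (twt a x0)).
Proof.
apply: tw_eq => [|x] /=; first by rewrite addr0.
have := twP a (oIl V (U x)) (oIr V (U x)) (subset_trans (oIl V (U x)) h).
rewrite mres_id => ->; congr (_ + _).
by rewrite mres_mres; exact: mres_irr.
Qed.

Lemma tw_decomp_inj (V : opens X) (h : V `<=` U x0) (b b' c c' : E V) :
  tw_spl h b + tw_emb c = tw_spl h b' + tw_emb c' -> b = b' /\ c = c'.
Proof.
move=> e; have e1 := congr1 (@tws _ _ _ _ _ _ _) e; have e2 := congr1 (fun a => twt a x0) e.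
rewrite /= !addr0 in e1; rewrite /= e1 in e2; split=> //.
move/addrI: e2 => /(congr1 (mres (subI (@subset_refl _ V) h))).
by rewrite !(mres_comp _ _ (@subset_refl _ V)) !mres_id.
Qed.
End Splitting.

Lemma tw_embD (V : opens X) : {morph @tw_emb V : b c / b + c}.
Proof. by move=> b c; apply: tw_eq => [|x] /=; rewrite ?addr0 ?mresD. Qed.
Lemma tw_emb0 (V : opens X) : tw_emb (0 : E V) = 0.
Proof. by apply: tw_eq => [|x] //=; rewrite (@mres0 _ _ E). Qed.

(** The splitting at x carries a frame of E to a frame: (s, t) has coordinates alpha_k + eps beta_k,
    where alpha and beta are the coordinates of s and of t_x. *)
Fact tw_locally_free (lfE : locally_free E) : locally_free twMod.
Proof.
move=> x; have [V Vx [r [e fr]]] := lfE x.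
exists (oI V (U x)); first by split=> //; exact: covP.
exists r, (fun k => tw_spl (oIr V (U x)) (mres (oIl V (U x)) (e k))) => W h a.
have hV : W `<=` V := subset_trans h (oIl V (U x)).
have hU : W `<=` U x := subset_trans h (oIr V (U x)).
have splE k : mres h (tw_spl (oIr V (U x)) (mres (oIl V (U x)) (e k)))
    = tw_spl hU (mres hV (e k)) :> twMod W.
  have := homfun_res (tw_split x) (oIr V (U x)) hU h (mres (oIl V (U x)) (e k)).
  by rewrite (mres_comp _ _ hV) => <-.
have sumE (c : 'I_r -> strSheaf X DN W) :
    \sum_k c k *: (mres h (tw_spl (oIr V (U x)) (mres (oIl V (U x)) (e k))) : twMod W)
    = tw_spl hU (\sum_k augH W (c k) *: mres hV (e k))
      + tw_emb (\sum_k eps_coef (c k) *: mres hV (e k)).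
  rewrite (big_morph (tw_spl hU) (homfunD (tw_split x) hU) (tw_spl0 hU)).
  rewrite (big_morph _ (@tw_embD W) (@tw_emb0 W)) -big_split.
  by apply: eq_bigr => k _; rewrite splE tw_splitZ.
have [alpha [aE aU]] := fr W hV (tws a).
have [beta [bE bU]] := fr W hV (mres (subI (@subset_refl _ W) hU) (twt a x)).
have aug_c f g : augH W (unitH W f + epsc W * unitH W g) = f.
  rewrite rmorphD rmorphM !aug_unitHom (_ : augH W (epsc W) = 0) ?mul0r ?addr0 //.
  exact: regfun_eq.
have coef_c f g : eps_coef (unitH W f + epsc W * unitH W g) = g.
  apply: regfun_eq => p; rewrite eps_coefE.
  rewrite -[X in X.2]/((unitH W f : regfun DN W) p + (epsc W * unitH W g : regfun DN W) p).
  rewrite regfunME epsM /= /unit_map.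
  rewrite -[LHS]/(regfun_val f p *: (0 : K^o) + regfun_val g p * 1).
  by rewrite scaler0 add0r mulr1.
exists (fun k => unitH W (alpha k) + epsc W * unitH W (beta k)); split.
  rewrite sumE {1}(tw_decomp hU a) {1}aE {1}bE.
  by congr (tw_spl _ _ + tw_emb _); apply: eq_bigr => k _; rewrite ?aug_c ?coef_c.
move=> c; rewrite sumE {1}(tw_decomp hU a) => /tw_decomp_inj[/aU ea /bU eb].
apply: functional_extensionality_dep => k.
by rewrite [RHS]regfun_dualE ea eb.
Qed.

Fact tw_reduction : @is_reduction _ _ _ DN twMod E tw_pi.
Proof.
split=> [V s x Vx|V a].
  exists (oI V (U x)), (oIl _ _); split; first by split=> //; exact: covP.
  by exists (tw_spl (oIr V (U x)) (mres (oIl _ _) s)).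
split=> [/= a0 x Vx|am].
  pose W := oI V (U x); have h : W `<=` V := oIl _ _; have hU : W `<=` U x := oIr _ _.
  exists W, h; split; first by split=> //; exact: covP.
  pose b := mres (subI (@subset_refl _ W) hU) (twt (tw_res h a) x).
  (* Where s vanishes, the section is eps sigma_x t_x, so a single term with coefficient eps
     suffices. *)
  exists 1%N, (fun=> @eps K : DN), (fun=> tw_spl hU b); split=> //.
  rewrite big_ord1 -[cstf W _]/(epsc W) tw_splitZ.
  rewrite [LHS](tw_decomp hU) [tws _]/= a0 (@mres0 _ _ E).
  have -> : augH W (epsc W) = 0 by exact: regfun_eq.
  have -> : eps_coef (epsc W) = 1 by exact: regfun_eq.
  by rewrite scale0r scale1r.
apply: mres_sep => x Vx; have [W [h [Wx [r [m [t [m0 e]]]]]]] := am x Vx.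
exists W, h; split=> //; rewrite -mhom_res e mhom_sum (@mres0 _ _ E) big1 // => k _.
rewrite mhomZ (_ : augH W _ = 0) ?scale0r //.
by rewrite [LHS](@strHom_cst _ _ X _ _ (art_aug DN)) m0; exact: regfun_eq.
Qed.

Lemma deformation_of_cocycle (lfE : locally_free E) :
  exists D : deformation DN E, kodaira_spencer D (cls (Cocycle dz)).
Proof.
exists (Deformation (tw_locally_free lfE) tw_reduction).
exists (Cocycle dz) => //; exists tw_split; split=> // x V h h0 h1 s.
rewrite -[cstf V _]/(epsc V) [_ *: _]tw_splitZ.
have -> : augH V (epsc V) = 0 by exact: regfun_eq.
have -> : eps_coef (epsc V) = 1 by exact: regfun_eq.
rewrite scale0r scale1r tw_spl0 add0r.
apply: tw_eq => [|w] /=; first by rewrite addr0.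
rewrite (tr_trans dz (oIr V (U w)) (subset_trans (oIl V (U w)) h0) (subset_trans (oIl V (U w)) h1)).
by rewrite (trE z h h0 h1); congr (_ + _); exact: tr_res.
Qed.
End TwistSheaf.

(** * The vector space structure *)

Section LinearStructure.
Context {K : fieldType} {n : nat} (X : set (projSpace K n)).
Notation DN := (@dual_numbers K).
Notation DN2 := (@dual_numbers2 K).
Variables (E : modSheaf (OX X)) (lfE : locally_free E).
Notation idE := (idfun : {linear H0 E -> H0 E}).

Lemma strHom_unit (A B : comAlgType K) (alpha : {lrmorphism A -> B}) (V : opens X)
    (f : OX X V) : strHom X alpha V (unitHom X A V f) = unitHom X B V f.
Proof. by apply: regfun_eq => x /=; rewrite /unit_map linearZ rmorph1. Qed.

Lemma cst_eps_emb (D : deformation DN E) (V : opens X) (c : K) (t : D V) :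
  cst V ((0, c) : DN) *: t = emb D lfE V (cst V (c : K^o) *: dfp D V t).
Proof.
rewrite mhomZ emb_dfp scalerA unitHom_cst mulrC; congr (_ *: _).
apply: regfun_eq => x; rewrite regfunME epsM; congr (_, _); exact/esym/mulr1.
Qed.

Lemma cls_add (U : @pcover X) (z1 z2 : cochain (endSheaf E) U 1)
    (d1 : delta z1 = 0) (d2 : delta z2 = 0) (d3 : delta (z1 + z2) = 0) :
  cls (Cocycle d3) = cls (Cocycle d1) + cls (Cocycle d2).
Proof.
rewrite [RHS]clsD; apply/clsE.
have h : finer U (meet_cover U U) by [].
exists U, (@finer_refl _ _), h; apply: coboundary_eq => /=.
rewrite !linearD /= !cres_comp; congr (_ + _); exact: cres_irr.
Qed.

Section Sum.
Variables (D : deformation DN2 E) (D1 D2 D3 : deformation DN E).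
Notation add1 := (sqz_map (fst : {linear (K^o * K^o)%type -> K^o}) : {lrmorphism DN2 -> DN}).
Notation add2 := (sqz_map (snd : {linear (K^o * K^o)%type -> K^o}) : {lrmorphism DN2 -> DN}).
Notation add3 := (sqz_map (fst \+ snd : {linear (K^o * K^o)%type -> K^o}) : {lrmorphism DN2 -> DN}).
Variables (th1 : modSheafHom (strHom X add1) D D1) (th2 : modSheafHom (strHom X add2) D D2)
  (th3 : modSheafHom (strHom X add3) D D3).
Hypothesis th1P : forall (V : opens X) (s : D V), dfp D1 V (th1 V s) = dfp D V s.
Hypothesis th2P : forall (V : opens X) (s : D V), dfp D2 V (th2 V s) = dfp D V s.
Hypothesis th3P : forall (V : opens X) (s : D V), dfp D3 V (th3 V s) = dfp D V s.

(** On the maximal ideal [sqz_map g] takes m to eps g(m), and eps times a section is [emb] of its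
    reduction, which [th] preserves. *)
Lemma theta_ker (g : {linear (K^o * K^o)%type -> K^o}) (D' : deformation DN E)
    (th : modSheafHom (strHom X (sqz_map g : {lrmorphism DN2 -> DN})) D D')
    (thP : forall (V : opens X) (s : D V), dfp D' V (th V s) = dfp D V s)
    (V : opens X) (r : nat) (m : 'I_r -> DN2) (t : 'I_r -> D V) (b : E V) :
  (forall k, art_aug DN2 (m k) = 0) ->
  th V (\sum_k (cst V (m k) : strSheaf X DN2 V) *: t k) = emb D' lfE V b ->
  b = \sum_k cst V (g (m k).2 : K^o) *: dfp D V (t k).
Proof.
move=> m0 e; apply: (@emb_inj _ _ _ _ D' lfE); rewrite -e !mhom_sum; apply: eq_bigr => k _.
rewrite -thP -cst_eps_emb mhomZ; congr (_ *: _).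
rewrite strHom_cst; congr (cst V _).
rewrite -[LHS]/((m k).1, g (m k).2); congr (_, _); exact: (m0 k).
Qed.

Lemma theta_ker_add (V : opens X) (u : D V) (b1 b2 b3 : E V) : dfp D V u = 0 ->
  th1 V u = emb D1 lfE V b1 -> th2 V u = emb D2 lfE V b2 -> th3 V u = emb D3 lfE V b3 ->
  b3 = b1 + b2.
Proof.
move=> u0 e1 e2 e3; apply: mres_sep => x Vx.
have [W [h [Wx [r [m [t [m0 ue]]]]]]] := (proj1 (dfp_ker u)) u0 x Vx.
exists W, h; split=> //; rewrite mresD.
have f1 := congr1 (mres h) e1; have f2 := congr1 (mres h) e2; have f3 := congr1 (mres h) e3.
rewrite -!mhom_res ue in f1 f2 f3.
rewrite (theta_ker th1P m0 f1) (theta_ker th2P m0 f2) (theta_ker th3P m0 f3).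
rewrite -big_split; apply: eq_bigr => k _ /=; rewrite -scalerDl; congr (_ *: _).
exact: regfun_eq.
Qed.

(** One family of splittings of the deformation over K[eps] x_K K[eps] is pushed forward to all
    three deformations. For these families the cocycles satisfy z3 = z1 + z2 exactly, not only up to
    a coboundary. *)
Lemma kodaira_spencer_sum a1 a2 a3 : kodaira_spencer D1 a1 -> kodaira_spencer D2 a2 ->
  kodaira_spencer D3 a3 -> a3 = a1 + a2.
Proof.
move=> k1 k2 k3; have [U [sigma sP]] := @splitting_cover _ _ _ _ lfE DN2 D.
pose s1 x := @comp_hom _ _ _ _ _ _ _ (strHom_unit add1) _ _ _ th1 _ (sigma x).
pose s2 x := @comp_hom _ _ _ _ _ _ _ (strHom_unit add2) _ _ _ th2 _ (sigma x).
pose s3 x := @comp_hom _ _ _ _ _ _ _ (strHom_unit add3) _ _ _ th3 _ (sigma x).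
have s1P x : splits (s1 x) by move=> V h s; rewrite /= th1P sP.
have s2P x : splits (s2 x) by move=> V h s; rewrite /= th2P sP.
have s3P x : splits (s3 x) by move=> V h s; rewrite /= th3P sP.
have [z1 [[_ z1P] [d1 /(kodaira_spencer_uniq lfE k1) ->]]] := ks_family_class lfE s1P.
have [z2 [[_ z2P] [d2 /(kodaira_spencer_uniq lfE k2) ->]]] := ks_family_class lfE s2P.
have [z3 [[_ z3P] [d3 /(kodaira_spencer_uniq lfE k3) ->]]] := ks_family_class lfE s3P.
have e : z3 = z1 + z2.
  apply: cochainP => x; apply: hom_onP => V h s.
  pose h0 := subset_trans h (@ccap_le _ U _ x ord0).
  pose h1 := subset_trans h (@ccap_le _ U _ x ord_max).
  apply: (@theta_ker_add V (sigma (x ord_max) V h1 s - sigma (x ord0) V h0 s)).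
  - by rewrite mhomB !sP subrr.
  - by rewrite mhomB; apply/eqP; rewrite subr_eq addrC; apply/eqP/(z1P _ _ h h0 h1).
  - by rewrite mhomB; apply/eqP; rewrite subr_eq addrC; apply/eqP/(z2P _ _ h h0 h1).
  - by rewrite mhomB; apply/eqP; rewrite subr_eq addrC; apply/eqP/(z3P _ _ h h0 h1).
by subst z3; exact: cls_add.
Qed.
End Sum.

Lemma Def_classP (A : artAlg K) (xi : Def idE A) : exists D, xi = Def_class D.
Proof. by case: xi => C [D e]; exists D; apply: eq_exist. Qed.

Lemma kodaira_spencer_scale (c : K) (D D' : deformation DN E)
    (th : modSheafHom (strHom X (sqz_map (c \*: idfun : {linear K^o -> K^o}) : {lrmorphism DN -> DN})) D D') a :
  (forall (V : opens X) (s : D V), dfp D' V (th V s) = dfp D V s) ->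
  kodaira_spencer D a -> kodaira_spencer D' (cst (oT : opens X) (c : K^o) *: a).
Proof.
move=> thP; apply: (kodaira_spencer_transport lfE _ _ thP) => V.
  by move=> f; exact: strHom_unit.
rewrite mulrC strHom_cst unitHom_cst; apply: regfun_eq => x.
rewrite regfunME epsM -[LHS]/((0, c *: (1 : K^o)) : DN); congr (_, _).
Qed.
End LinearStructure.

(** * The Kodaira-Spencer map on the tangent space and its image *)

Theorem corollary3p8 (K : closedFieldType) (charK : [pchar K] =i pred0)
    (n : nat) (X : set (projSpace K n))
    (closedX : closed X) (irreducibleX : irreducible X) (smoothX : smooth X)
    (H1_OX : forall a : cechH (selfMod (OX X)) 1, a = 0)
    (H2_OX : forall a : cechH (selfMod (OX X)) 2, a = 0)
    (E : modSheaf (OX X)) (lfE : locally_free E) :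
  exists Phi : tangent_space E -> cechH (endSheaf E) 1,
    [/\ forall D : pair_deformation (idfun : {linear H0 E -> H0 E}) (dual_numbers : artAlg K),
          kodaira_spencer D (Phi (Def_class D)),
        injective Phi,
        forall a : cechH (endSheaf E) 1,
          (exists xi, Phi xi = a) <-> forall s : H0 E, cup a s = 0,
        forall (c : K) (xi eta : tangent_space E), tscaled c xi eta ->
          Phi eta = (cstf (oT : opens X) (c : K^o) : OX X oT) *: Phi xi
      & forall xi1 xi2 eta : tangent_space E, tsummed xi1 xi2 eta ->
          Phi eta = Phi xi1 + Phi xi2].
Proof.
(* The class of one representative serves for all of them, by invariance under isomorphism; this
   makes the choice of [Phi] legitimate. *)
have ks (xi : tangent_space E) : exists a, forall D, xi = Def_class D -> kodaira_spencer D a.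
  have [D ->] := Def_classP xi; have [a Da] := kodaira_spencer_exists lfE D.
  by exists a => D' /Def_class_inj/(pair_iso_ks lfE); exact.
have /choice_dep[Phi PhiP] := ks; have {}PhiP D := PhiP (Def_class D) D erefl.
exists Phi; split=> [//|xi eta|a|c xi eta|xi1 xi2 eta].
- have [D ->] := Def_classP xi; have [D' ->] := Def_classP eta => e.
  by apply: (kodaira_spencer_Def_class lfE (PhiP D)); rewrite e.
- split=> [[xi <-] s|a0].
    have [D ->] := Def_classP xi.
    by apply/(cup0P lfE s (PhiP D)); exists (pdi D (tpure s 1)); exact: pdi1.
  have [[U z dz] az] := clsP a.
  have [D Da] := deformation_of_cocycle dz lfE; rewrite -az in Da.
  have [s|P PD] := @pair_of_deformation _ _ _ _ _ D; first by apply/(cup0P lfE s Da).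
  exists (Def_class P); apply: (kodaira_spencer_uniq lfE (PhiP P)).
  by rewrite PD.
- move=> [D [D' [th [-> -> thP _]]]].
  apply: (kodaira_spencer_uniq lfE (PhiP D')).
  exact: (kodaira_spencer_scale lfE thP (PhiP D)).
move=> [zeta [[D1 [D1' [th1 [-> -> th1P _]]]] [D2 [D2' [th2 [e2 -> th2P _]]]]
  [D3 [D3' [th3 [e3 -> th3P _]]]]]].
(* The three graphs may present [zeta] by different representatives; composing with isomorphisms
   moves all three maps to the source [D1]. *)
have [phi2 [_ [_ phi2P _ _]]] := Def_class_inj e2.
have [phi3 [_ [_ phi3P _ _]]] := Def_class_inj e3.
pose th2' := @comp_mhom _ _ _ _ (idRSH _) _ _ (fun _ _ => erefl) _ _ _ th2 phi2.
pose th3' := @comp_mhom _ _ _ _ (idRSH _) _ _ (fun _ _ => erefl) _ _ _ th3 phi3.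
apply: (kodaira_spencer_sum lfE (D := D1) (th1 := th1) (th2 := th2') (th3 := th3')) => // V s.
  by rewrite /= th2P phi2P.
by rewrite /= th3P phi3P.
Qed.
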